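(* Let $(V_*,Q,\mathfrak{a},N_0)$ be a polarized Hodge-Lefschetz module of weight $k$ and let $\mathcal{C}\subset\mathfrak{a}$ be its polarizing cone. Let $0\le m\leq k$ and let $T_1,\dots,T_m \in \mathcal{C}$. Then the map $$T_1\cdots T_m \colon V_m \to V_{-m}$$ is an isomorphism.
   Context: Lefschetz property. Let $V=V_*=\bigoplus_{\ell\in\mathbb{Z}}V_\ell$ be a $\mathbb{Z}$-graded finite-dimensional real vector space. A linear map $N\in \mathrm{End}_{-2}(V)$ (i.e. $N V_\ell\subset V_{\ell-2}$ for all $\ell$) satisfies the Lefschetz property relative to $V_*$ if $N^\ell\colon V_\ell\to V_{-\ell}$ is an isomorphism for all $\ell\ge 0$. For such $N$ and $\ell\ge0$, the primitive subspace $P_\ell(N)\subset V_\ell$ is the kernel of $N^{\ell+1}\colon V_\ell\to V_{-\ell-2}$. Polarized Hodge structures. A Hodge structure of weight $d$ on a real vector space $H$ is a decomposition $H_{\mathbb{C}}=\bigoplus_{p+q=d}H^{p,q}$ of its complexification with $\overline{H^{p,q}}=H^{q,p}$. It is polarized by a real bilinear form $B$ on $H$ (extended complex-bilinearly to $H_{\mathbb{C}}$) of parity $(-1)^d$ (symmetric if $d$ is even, skew-symmetric if $d$ is odd) if the Hermitian form $B^h(\cdot,\cdot):=i^{-d}B(\cdot,\overline{\,\cdot\,})$ makes the decomposition orthogonal and $(-1)^pB^h$ is positive definite on $H^{p,d-p}$. Polarized Hodge-Lefschetz modules. Let $V_*$ be a $\mathbb{Z}$-graded finite-dimensional real vector space,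 $k$ a positive integer, and $S$ a non-degenerate real bilinear form on $V$ of parity $(-1)^k$. Let $\mathfrak{o}(V,S)$ be the Lie algebra of infinitesimal automorphisms of $(V,S)$, i.e. those $T\in\mathrm{End}(V)$ with $S(Tu,v)+S(u,Tv)=0$, and let $\mathfrak{o}_{-2}(V,S)=\mathfrak{o}(V,S)\cap\mathrm{End}_{-2}(V)$. Let $\mathfrak{a}\subset\mathfrak{o}_{-2}(V,S)$ be an abelian subspace (its elements commute pairwise) and $N_0\in\mathfrak{a}$. Then $(V_*,S,\mathfrak{a},N_0)$ is a polarized Hodge-Lefschetz module of weight $k$ if: (1) there is a bigrading $V_{\mathbb{C}}=\bigoplus_{0\le p,q\le k}V^{p,q}$ with $V^{q,p}=\overline{V^{p,q}}$ such that $(V_\ell)_{\mathbb{C}}=\bigoplus_{p+q=\ell+k}V^{p,q}$ (so it restricts to a Hodge structure of weight $k+\ell$ on $V_\ell$); (2) $T(V^{p,q})\subset V^{p-1,q-1}$ for all $T\in\mathfrak{a}$; (3) $N_0$ satisfies the Lefschetz property; (4) for $\ell\ge0$, the induced Hodge structure on $P_\ell(N_0)\subset V_\ell$ is polarized by the form $S_\ell(\cdot,\cdot):=S(\cdot,N_0^\ell\,\cdot)$. The polarizing cone $\mathcal{C}$ of $(V_*,S,\mathfrak{a},N_0)$ is the largest convex cone in $\mathfrak{a}$ containing $N_0$ and such that every element of $\mathcal{C}$ has the Lefschetz property relative to $V_*$. An empty product of endomorphisms is the identity. *)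

(* Defs.v *)
From HB Require Import structures.
From mathcomp Require Import all_boot all_order all_algebra.
From mathcomp Require Import classical_sets.
From mathcomp Require Import complex.

Set Implicit Arguments.
Unset Strict Implicit.
Unset Printing Implicit Defensive.

Import Order.TTheory GRing.Theory Num.Theory.
Import VectorInternalTheory.
Local Open Scope ring_scope.

Section LinearMaps.
Variables (K : fieldType) (W : vectType K).
Implicit Types (f N : 'End(W)) (X Y : {vspace W}).

Definition lfun_pow N (n : nat) : 'End(W) := iter n (comp_lfun N) \1%VF.

Definition lfun_prod (m : nat) (T : 'I_m -> 'End(W)) : 'End(W) :=
  \big[@comp_lfun K W W W / \1%VF]_(i < m) T i.

Definition restricts_to_iso f X Y : Prop :=
  {in X &, injective f} /\ (f @: X)%VS = Y.

(* X is the internal direct sum of the U i.  The index type may be infinite: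
   independence of all finite subfamilies forces U i = 0 for almost all i. *)
Definition direct_sum_decomposition (I : eqType) (U : I -> {vspace W}) X : Prop :=
  [/\ forall i, (U i <= X)%VS,
      forall s : seq I, uniq s -> directv (\sum_(i <- s) U i)%VS
    & exists s : seq I, (X <= \sum_(i <- s) U i)%VS].

End LinearMaps.

(* 0 need not belong to a convex cone. *)
Definition convex_cone (K : numDomainType) (E : lmodType K) (C : set E) : Prop :=
  forall (s t : K) (x y : E), 0 < s -> 0 < t -> C x -> C y -> C (s *: x + t *: y).

(* The complexification of V: the pair (x, y) stands for x + i y. *)
Definition complexification (R : rcfType) (V : vectType R) : Type := (V * V)%type.

Section Complexification.
Variables (R : rcfType) (V : vectType R).
Local Notation VC := (complexification V).

HB.instance Definition _ := GRing.Zmodule.copy VC (V * V)%type.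

Definition complexification_scale (c : R[i]) (w : VC) : VC :=
  (complex.Re c *: w.1 - complex.Im c *: w.2,
   complex.Re c *: w.2 + complex.Im c *: w.1).

Fact complexification_scaleA a b w :
  complexification_scale a (complexification_scale b w) =
  complexification_scale (a * b) w.
Proof.
case: a b w => [a1 a2] [b1 b2] [x y]; rewrite /complexification_scale /=.
rewrite !(scalerBr, scalerDr, scalerA) !(scalerBl, scalerDl) !opprD.
by congr pair; rewrite [X in _ + X = _]addrC addrACA.
Qed.

Fact complexification_scale1 : left_id 1 complexification_scale.
Proof.
by case=> x y; rewrite /complexification_scale /= !scale1r !scale0r subr0 addr0.
Qed.

Fact complexification_scaleDr : right_distributive complexification_scale +%R.
Proof.
case=> a b [x y] [z t]; rewrite /complexification_scale /=.
by congr pair; rewrite !scalerDr ?opprD addrACA.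
Qed.

Fact complexification_scaleDl w :
  {morph complexification_scale^~ w : a b / a + b}.
Proof.
case: w => x y [a b] [c d]; rewrite /complexification_scale /=.
by congr pair; rewrite !scalerDl ?opprD addrACA.
Qed.

HB.instance Definition _ := GRing.Zmodule_isLmodule.Build R[i] VC
  complexification_scaleA complexification_scale1
  complexification_scaleDr complexification_scaleDl.

Fact complexification_findim : Vector.axiom (dim V) VC.
Proof.
exists (fun w : VC => \row_j (v2r w.1 0 j +i* v2r w.2 0 j)%C).
  case=> a b [x y] [z t]; apply/rowP=> j; rewrite !mxE /=.
  by rewrite !linearD linearN !linearZ /= !mxE mulrN.
exists (fun r : 'rV[R[i]]_(dim V) =>
    (r2v (\row_j complex.Re (r 0 j)), r2v (\row_j complex.Im (r 0 j))) : VC).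
  case=> x y; congr pair; apply: (can_inj v2rK); rewrite r2vK;
    by apply/rowP=> j; rewrite !mxE.
by move=> r; apply/rowP=> j; rewrite !mxE /= !r2vK !mxE; case: (r 0 j).
Qed.

HB.instance Definition _ :=
  Lmodule_hasFinDim.Build R[i] VC complexification_findim.

Definition of_real (x : V) : VC := (x, 0).

Definition conjv (w : VC) : VC := (w.1, - w.2).

Definition complexify_space (H : {vspace V}) : {vspace VC} :=
  <<[seq of_real x | x <- vbasis H]>>%VS.

Definition complexify_map (T : V -> V) (w : VC) : VC := (T w.1, T w.2).

Definition complexify_form (B : {biscalar V}) (u v : VC) : R[i] :=
  ((B u.1 v.1 - B u.2 v.2) +i* (B u.1 v.2 + B u.2 v.1))%C.

End Complexification.

Section HodgeStructures.
Variables (R : rcfType) (V : vectType R).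
Local Notation VC := (complexification V).
Implicit Types (d : int) (H : {vspace V}) (Hpq : int -> int -> {vspace VC}).

(* Only the components Hpq p q with p + q = d are relevant. *)
Definition hodge_structure d H Hpq : Prop :=
  direct_sum_decomposition (fun p : int => Hpq p (d - p)) (complexify_space H) /\
  (forall p q, p + q = d -> forall w, (conjv w \in Hpq q p) = (w \in Hpq p q)).

(* 'i%C is 0 +i* 1 itself, not the root of -1 chosen by numClosedFieldType. *)
Definition hodge_hermitian_form d (B : {biscalar V}) (u v : VC) : R[i] :=
  ('i%C ^ (- d)) * complexify_form B u (conjv v).

Definition polarized_hodge_structure d H Hpq (B : {biscalar V}) : Prop :=
  [/\ hodge_structure d H Hpq,
      {in H &, forall u v, B u v = (-1) ^ d * B v u},
      forall p p' : int, p != p' ->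
        {in Hpq p (d - p) & Hpq p' (d - p'),
          forall u v, hodge_hermitian_form d B u v = 0}
    & forall p : int, {in Hpq p (d - p), forall u, u != 0 ->
        0 < (-1) ^ p * hodge_hermitian_form d B u u}].

End HodgeStructures.

Section HodgeLefschetz.
Variables (R : rcfType) (V : vectType R) (Vg : int -> {vspace V}).
Local Notation VC := (complexification V).

Definition degree_minus2 (N : 'End(V)) : Prop :=
  forall l : int, (N @: Vg l <= Vg (l - 2))%VS.

Definition lefschetz_property (N : 'End(V)) : Prop :=
  degree_minus2 N /\
  forall l : nat, restricts_to_iso (lfun_pow N l) (Vg l%:Z) (Vg (- l%:Z)).

Definition primitive_space (N : 'End(V)) (l : nat) : {vspace V} :=
  (Vg l%:Z :&: lker (lfun_pow N l.+1))%VS.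

Definition infinitesimal_automorphism (S : {biscalar V}) (T : 'End(V)) : Prop :=
  forall u v, S (T u) v + S u (T v) = 0.

Definition lefschetz_form (S : {biscalar V}) (N : 'End(V)) (l : nat) (u v : V) : R :=
  S u (lfun_pow N l v).

Fact lefschetz_form_bilinear S N l :
  bilinear_for *%R *%R (lefschetz_form S N l).
Proof.
by split=> u c x y; rewrite /lefschetz_form ?linearPl // linearP linearPr.
Qed.

HB.instance Definition _ S N l :=
  bilinear_isBilinear.Build R V V R *%R *%R (lefschetz_form S N l)
    (lefschetz_form_bilinear S N l).

Record hodge_lefschetz_bigrading (k : nat) (S : {biscalar V})
    (a : {vspace 'End(V)}) (N0 : 'End(V)) (Vpq : int -> int -> {vspace VC}) :
    Prop := {
  bigrading_direct_sum :
    direct_sum_decomposition (fun pq : int * int => Vpq pq.1 pq.2) fullv;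
  bigrading_support : forall p q : int,
    ~~ ((0 <= p <= k%:Z) && (0 <= q <= k%:Z)) -> Vpq p q = 0%VS;
  bigrading_conj : forall p q w, (conjv w \in Vpq q p) = (w \in Vpq p q);
  bigrading_graded : forall l : int,
    direct_sum_decomposition (fun p : int => Vpq p (l + k%:Z - p))
      (complexify_space (Vg l));
  bigrading_action : forall T, T \in a -> forall p q w,
    w \in Vpq p q -> complexify_map T w \in Vpq (p - 1) (q - 1);
  bigrading_polarized : forall l : nat,
    polarized_hodge_structure (k%:Z + l%:Z) (primitive_space N0 l)
      (fun p q => complexify_space (primitive_space N0 l) :&: Vpq p q)%VS
      (lefschetz_form S N0 l)
}.

Record polarized_hodge_lefschetz_module (k : nat) (S : {biscalar V})
    (a : {vspace 'End(V)}) (N0 : 'End(V)) : Prop := {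
  phl_grading : direct_sum_decomposition Vg fullv;
  phl_weight : (0 < k)%N;
  phl_parity : forall u v, S u v = (-1) ^+ k * S v u;
  phl_nondegenerate : forall u, (forall v, S u v = 0) -> u = 0;
  phl_algebra : forall T, T \in a ->
    infinitesimal_automorphism S T /\ degree_minus2 T;
  phl_abelian : {in a &, forall T T', (T \o T' = T' \o T)%VF};
  phl_base : N0 \in a;
  phl_lefschetz : lefschetz_property N0;
  phl_bigrading : exists Vpq, hodge_lefschetz_bigrading k S a N0 Vpq
}.

Definition lefschetz_cone (a : {vspace 'End(V)}) (N0 : 'End(V))
    (C : set 'End(V)) : Prop :=
  [/\ convex_cone C, forall T, C T -> T \in a, C N0
    & forall T, C T -> lefschetz_property T].

Definition polarizing_cone (a : {vspace 'End(V)}) (N0 : 'End(V))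
    (C : set 'End(V)) : Prop :=
  lefschetz_cone a N0 C /\
  forall C', lefschetz_cone a N0 C' -> (C' `<=` C)%classic.

End HodgeLefschetz.

(* Main.v *)
From HB Require Import structures.
Require Import Defs.
From mathcomp Require Import all_boot all_order all_algebra.
From mathcomp Require Import boolp classical_sets reals complex.
From mathcomp Require Import ring lra zify.

(** Fix a chain of Hodge types [V^(p+i, q+i)], of degree [e + 2i] in the grading,
    and let [S] be the polarizing form.  A product [w] of [e + 2i] elements of the
    cone defines on [V^(p+i, q+i)] the Hermitian form [S(u, w (conj v))] up to a
    constant factor, which is the same along the chain.  The theorem follows once
    this form is nondegenerate for every [w]: a vector killed by [w] is in the
    radical, so [w] is injective on each type, hence on [V_m], and [V_m] and
    [V_(-m)] have the same dimension.

    The form is proved to have the signature of the one given by the power of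
    [N0], which the Hodge-Riemann relations determine: the negative index [n_i] on
    [V^(p+i, q+i)] satisfies [n_i + n_(i+1) = dim V^(p+i+1, q+i+1)].  One half is
    formal ([neg_part_image]): for [A] in the cone, the form of [w] restricted to
    the image of [A] is minus the form of [w A A] one step up, so going down the
    degrees the negative index of the form of [w] is always at least [n_i].

    The other half is a deformation inside the convex cone
    ([pos_part_segment]).  Powers [A^l] are deformed to powers of [N0]; the
    Lefschetz property says that the form never degenerates on the way
    ([power_index]).  A mixed word [s T A^r] is deformed by moving [A] to [T]
    ([mixed_index]); at the end point it is [s T^(r+1)], known by induction on the
    number of distinct factors.  Suppose that the form first degenerates at some
    [A], with radical vector [u].  Then [T u] is nonzero and primitive for the word
    [s A^(r-1)], whose Hodge-Riemann relation ([primitive_positive]) is available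
    by induction.  It says that [S(u, s T T A^(r-1) (conj u))], which up to a
    positive factor is the derivative of the form at [u] in the direction of [T],
    has the sign opposite to the polarization.  So slightly closer to [T] the form
    has a negative space of dimension [n_i + 1] ([posdef_crossing]), although the
    signature there is still the expected one.

    All forms are replaced by their real parts on the underlying real spaces; a
    single Hodge type at a time makes this lossless. *)

Set Implicit Arguments.
Unset Strict Implicit.
Unset Printing Implicit Defensive.

Import Order.TTheory GRing.Theory Num.Theory.
Local Open Scope ring_scope.

Lemma linear_lfun (K : fieldType) (X Y : vectType K) (f : X -> Y) :
  linear f -> exists g : 'Hom(X, Y), forall u, g u = f u.
Proof.
move=> f_lin.
pose fM := GRing.isLinear.Build K X Y *:%R f f_lin.
pose fL : {linear X -> Y} := HB.pack f fM.
by exists (linfun fL) => u; rewrite lfunE.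
Qed.

(** * Indices of real symmetric bilinear forms *)

Section RealForms.
Variables (R : realFieldType) (X : vectType R).
Implicit Types (b h : X -> X -> R) (U W E : {vspace X}).

Definition bilin b := bilinear_for *%R *%R b.
Definition posdef b U := forall u, u \in U -> u != 0 -> 0 < b u u.

Section Bilin.
Variable b : X -> X -> R.
Hypothesis bb : bilin b.

Lemma bilin_pl a u v w : b (a *: u + v) w = a * b u w + b v w.
Proof. by case: bb => + _; apply. Qed.
Lemma bilin_pr a u v w : b w (a *: u + v) = a * b w u + b w v.
Proof. by case: bb => _; apply. Qed.
Lemma bilinDl u v w : b (u + v) w = b u w + b v w.
Proof. by rewrite -{1}[u]scale1r bilin_pl mul1r. Qed.
Lemma bilinDr u v w : b w (u + v) = b w u + b w v.
Proof. by rewrite -{1}[u]scale1r bilin_pr mul1r. Qed.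
Lemma bilin0l w : b 0 w = 0.
Proof.
have := bilinDl 0 0 w; rewrite addr0 => /eqP.
by rewrite addrC -subr_eq subrr => /eqP.
Qed.
Lemma bilin0r w : b w 0 = 0.
Proof.
have := bilinDr 0 0 w; rewrite addr0 => /eqP.
by rewrite addrC -subr_eq subrr => /eqP.
Qed.
Lemma bilinZr a u w : b w (a *: u) = a * b w u.
Proof. by rewrite -[a *: u]addr0 bilin_pr bilin0r addr0. Qed.
End Bilin.


Lemma dim_add_line U u : u \notin U -> \dim (U + <[u]>)%VS = (\dim U).+1.
Proof.
move=> uU; have u0 : u != 0 by apply: contraNneq uU => ->; rewrite mem0v.
rewrite dimv_disjoint_sum ?dim_vline ?u0 ?addn1 //.
apply/eqP; rewrite -subv0; apply/subvP => x /memv_capP[xW /vlineP[c cx]].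
rewrite memv0 cx; have [->|c0] := eqVneq c 0; first by rewrite scale0r.
by move: xW; rewrite cx rpredZeq (negPf c0) (negPf uU).
Qed.

Lemma definite_cap b U W : posdef b U -> posdef (fun u v => - b u v) W ->
  (U :&: W = 0)%VS.
Proof.
move=> bU bW; apply/eqP; rewrite -subv0; apply/subvP => x /memv_capP[xU xW].
rewrite memv0; apply: contraT => x0.
by have := addr_gt0 (bU x xU x0) (bW x xW x0); rewrite subrr ltxx.
Qed.

(** A positive and a negative subspace meet trivially; exhibiting one bounds the
    dimension of the other.  Every upper bound on an index below comes from
    this. *)
Lemma index_le_dim b U W E : (U <= E)%VS -> (W <= E)%VS ->
  posdef b U -> posdef (fun u v => - b u v) W -> (\dim U + \dim W <= \dim E)%N.
Proof.
move=> UE WE bU bW; rewrite -dimv_disjoint_sum ?(definite_cap bU bW) //.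
by rewrite dimvS // subv_add UE.
Qed.

Lemma orthogonal_complement b W E : bilin b ->
  exists U, [/\ (U <= E)%VS, (\dim E <= \dim U + \dim W)%N
    & forall u, u \in E -> (u \in U) = `[< forall w, w \in W -> b u w = 0 >]].
Proof.
move=> bb; pose n := \dim W.
have [|f fE] := @linear_lfun R X 'rV[R]_n (fun u => \row_j b u (vbasis W)`_j).
  by move=> a u v; apply/rowP=> j; rewrite !mxE bilin_pl.
exists (E :&: lker f)%VS; split; first exact: capvSl.
  rewrite -(limg_ker_dim f E) leq_add2l.
  by rewrite (leq_trans (dimvS (subvf _))) // dimvf /dim /= mul1n.
move=> u uE; rewrite memv_cap uE memv_ker /=; apply/eqP/asboolP => [f0 w wW|uW].
  rewrite (coord_vbasis wW).
  have: forall I (r : seq I) (c : I -> R) (x : I -> X), (forall i, b u (x i) = 0) ->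
      b u (\sum_(i <- r) c i *: x i) = 0.
    move=> I r c x bx; elim/big_rec: _ => [|i y _ IH]; first exact: bilin0r.
    by rewrite bilin_pr // bx IH mulr0 addr0.
  apply=> i; move/rowP: f0 => /(_ i).
  by rewrite fE !mxE.
by rewrite fE; apply/rowP => j; rewrite !mxE uW // vbasis_mem // mem_nth // size_tuple.
Qed.

Lemma square_le_add (x y : R) : `|x * y| <= x ^+ 2 + y ^+ 2.
Proof. by rewrite ler_norml; apply/andP; split; nra. Qed.

Lemma bilin_square h e : bilin h ->
  bilin (fun x y => (h e x + h x e) * (h e y + h y e)).
Proof.
move=> hb; split=> [u' c x y|u c x y] /=; rewrite !(bilin_pl hb, bilin_pr hb);
  ring.
Qed.

(** All forms are bounded relative to a positive definite one.  This replaces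
    compactness of the unit sphere.  In the induction one splits off a vector
    [e]; the cross term between [e] and its orthogonal complement is bounded by
    applying the induction hypothesis to the square of the linear form
    [x |-> h e x + h x e], which is itself a bilinear form. *)
Lemma posdef_dominates b U h : bilin b -> (forall u v, b u v = b v u) ->
  posdef b U -> bilin h ->
  exists2 K, 0 <= K & forall u, u \in U -> `|h u u| <= K * b u u.
Proof.
move=> bb bs; have [n] := ubnP (\dim U); elim: n U h => // n IH U h dimU bU hb.
have [/eqP U0|U0] := boolP (U == 0%VS).
  exists 0 => // u; rewrite U0 memv0 => /eqP ->.
  by rewrite (bilin0l hb) normr0 mul0r.
set e := vpick U; have eU : e \in U by exact: memv_pick.
have e0 : e != 0 by rewrite vpick0.
have bee := bU e eU e0.
have [|f fE] := @linear_lfun R X R^o (fun u => b e u).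
  by move=> a u v; rewrite bilin_pr.
pose U' := (U :&: lker f)%VS.
have U'U : (U' <= U)%VS by exact: capvSl.
have dimU' : (\dim U' < n)%N.
  rewrite (leq_trans _ (_ : \dim U <= n)%N) // ltn_neqAle dimvS // andbT.
  rewrite (dimv_leqif_eq U'U); apply: contraL bee => /eqP U'E.
  by move: eU; rewrite -{1}U'E memv_cap memv_ker fE => /andP[_ /eqP ->]; rewrite ltxx.
have bU' : posdef b U' by move=> u /(subvP U'U); exact: bU.
have [K1 K1ge0 hK1] := IH U' h dimU' bU' hb.
have [K2 K2ge0 hK2] := IH U' _ dimU' bU' (bilin_square e hb).
pose K3 := (`|h e e| + 1) / b e e.
have K3ge0 : 0 <= K3 by rewrite divr_ge0 ?addr_ge0 // ltW.
exists (K1 + K2 + K3); first by rewrite !addr_ge0.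
move=> u uU; pose a := b e u / b e e; pose u' := u - a *: e.
have bue' : b e u' = 0.
  by rewrite /u' -scaleNr addrC bilin_pr // mulNr divfK ?gt_eqF // addNr.
have u'U : u' \in U'.
  by rewrite memv_cap memv_ker fE bue' eqxx andbT memvB ?memvZ.
have uE : u = a *: e + u' by rewrite addrC subrK.
clearbody u' a; subst u.
have := hK1 u' u'U; have := hK2 u' u'U.
have u'0 : 0 <= b u' u'.
  by have [->|u'0] := eqVneq u' 0; [rewrite bilin0l|rewrite ltW ?bU'].
have -> : b (a *: e + u') (a *: e + u') = a ^+ 2 * b e e + b u' u'.
  rewrite !(bilin_pl bb, bilin_pr bb) (bs u' e) bue' !(mulr0, addr0, add0r).
  by rewrite mulrA expr2.
have -> : h (a *: e + u') (a *: e + u') =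
   a ^+ 2 * h e e + a * (h e u' + h u' e) + h u' u'.
  by rewrite !(bilin_pl hb, bilin_pr hb); ring.
set s := h e u' + h u' e; set B := b u' u' in u'0 *.
rewrite -expr2 ger0_norm ?sqr_ge0 // => s2 hB.
have K3E : K3 * b e e = `|h e e| + 1 by rewrite divfK ?gt_eqF.
apply: le_trans (ler_normD _ _) _; apply: le_trans (lerD (ler_normD _ _) hB) _.
apply: le_trans (lerD (lerD (lexx _) (square_le_add a s)) (lexx _)) _.
rewrite normrM (ger0_norm (sqr_ge0 a)).
have a2 := sqr_ge0 a.
have : 0 <= (K1 + K2) * (a ^+ 2 * b e e) by rewrite mulr_ge0 ?addr_ge0 // mulr_ge0 // ltW.
have : 0 <= K3 * B by rewrite mulr_ge0.
have -> : (K1 + K2 + K3) * (a ^+ 2 * b e e + B) =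
  (K1 + K2) * (a ^+ 2 * b e e) + a ^+ 2 * (K3 * b e e) + K1 * B + K2 * B + K3 * B by ring.
rewrite K3E; lra.
Qed.

Lemma polynomial_bound T (D : T -> Prop) (N : T -> R) (F : nat -> T -> R) n :
  (forall i, exists2 K, 0 <= K & forall x, D x -> `|F i x| <= K * N x) ->
  exists2 K, 0 <= K & forall t, `|t| <= 1 -> forall x, D x ->
    `|\sum_(i < n) t ^+ i * F i x| <= K * N x.
Proof.
move=> FK; elim: n => [|n [K K0 IH]].
  by exists 0 => // t _ x _; rewrite big_ord0 normr0 mul0r.
have [K' K'0 IH'] := FK n; exists (K + K'); first exact: addr_ge0.
move=> t t1 x Dx; rewrite big_ord_recr /= mulrDl.
apply: le_trans (ler_normD _ _) (lerD (IH t t1 x Dx) _).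
apply: le_trans (IH' x Dx); rewrite normrM normrX ler_piMl //.
by rewrite exprn_ile1.
Qed.

(** Definiteness on a fixed subspace is an open condition along a polynomial
    family of forms; the perturbation is dominated by [b]. *)
Lemma posdef_open b U (F : nat -> X -> X -> R) n :
  bilin b -> (forall u v, b u v = b v u) -> (forall i, bilin (F i)) ->
  posdef b U ->
  exists2 d, 0 < d & forall t, `|t| <= d ->
    posdef (fun u v => b u v + t * \sum_(i < n) t ^+ i * F i u v) U.
Proof.
move=> bb bs Fb bU.
have [|K K0 FK] := @polynomial_bound X (fun u => u \in U) (fun u => b u u)
    (fun i u => F i u u) n.
  by move=> i; exact: posdef_dominates.
have K1 : 0 < 1 + K by rewrite ltr_pwDl.
exists (1 + K)^-1; first by rewrite invr_gt0.
move=> t td u uU u0; have bu := bU u uU u0.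
have t1 : `|t| <= 1 by rewrite (le_trans td) // invf_le1 // lerDl.
have := FK t t1 u uU; set s := \sum_(i < n) _ => sK.
have tK : `|t| * (1 + K) <= 1 by rewrite -ler_pdivlMr // mul1r.
have : `|t * s| < b u u.
  rewrite normrM (le_lt_trans (ler_wpM2l (normr_ge0 t) sK)) //.
  rewrite mulrA gtr_pMl //.
  have [->|t0] := eqVneq t 0; first by rewrite normr0 mul0r.
  by rewrite (lt_le_trans _ tK) // mulrDr mulr1 ltrDr normr_gt0.
by rewrite ltr_norml => /andP[+ _]; lra.
Qed.

(** A radical vector [u] becomes a new positive direction as soon as the first
    derivative of the family is positive at [u].  The family is not small
    relative to [b] in the direction [u], so the error is measured by
    [b w w + c ^+ 2] at the vector [w + c *: u]: the first-order term
    contributes [t * c ^+ 2 * F 0 u u], which beats both the cross term, up to a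
    multiple of [t * b w w], and the terms of order [t ^+ 2]. *)
Lemma posdef_crossing b W u (F : nat -> X -> X -> R) n :
  bilin b -> (forall u v, b u v = b v u) -> (forall i, bilin (F i)) ->
  posdef b W -> (forall w, w \in W -> b u w = 0) -> b u u = 0 -> 0 < F 0 u u ->
  exists2 d, 0 < d & forall t, 0 < t <= d ->
    posdef (fun x y => b x y + t * \sum_(i < n.+1) t ^+ i * F i x y)
      (W + <[u]>)%VS.
Proof.
move=> bb bs Fb bW uW buu g0; set g := F 0 u u in g0.
have bW0 w : w \in W -> 0 <= b w w.
  by have [->|w0] := eqVneq w 0; [rewrite bilin0l|move=> wW; rewrite ltW ?bW].
pose D (x : X * R) := x.1 \in W.
pose N (x : X * R) := b x.1 x.1 + x.2 ^+ 2.
have [|K K0 FK] := @polynomial_bound _ D N (fun i x =>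
    F i.+1 (x.1 + x.2 *: u) (x.1 + x.2 *: u)) n.
  move=> i; have Fib := Fb i.+1.
  have [K1 K10 FK1] := posdef_dominates bb bs bW Fib.
  have [K2 K20 FK2] := posdef_dominates bb bs bW (bilin_square u Fib).
  pose K3 := `|F i.+1 u u| + 1; have K30 : 0 <= K3 by rewrite addr_ge0.
  exists (K1 + K2 + K3); first by rewrite !addr_ge0.
  move=> [w c] /= wW; have := FK1 w wW; have := FK2 w wW.
  rewrite /N /= [w + _]addrC; set B := b w w; set s := F i.+1 u w + _.
  have B0 : 0 <= B := bW0 w wW.
  have -> : F i.+1 (c *: u + w) (c *: u + w) =
     c ^+ 2 * F i.+1 u u + c * s + F i.+1 w w.
    by rewrite !(bilin_pl Fib, bilin_pr Fib) /s; ring.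
  rewrite -expr2 ger0_norm ?sqr_ge0 // => s2 hB.
  apply: le_trans (ler_normD _ _) _; apply: le_trans (lerD (ler_normD _ _) hB) _.
  apply: le_trans (lerD (lerD (lexx _) (square_le_add c s)) (lexx _)) _.
  rewrite normrM (ger0_norm (sqr_ge0 c)).
  have : 0 <= (K1 + K2) * c ^+ 2 by rewrite mulr_ge0 ?addr_ge0 ?sqr_ge0.
  have : 0 <= K3 * B by rewrite mulr_ge0.
  rewrite /K3; nra.
have [K1 K10 FK1] := posdef_dominates bb bs bW (Fb 0).
have [K2 K20 FK2] := posdef_dominates bb bs bW (bilin_square u (Fb 0)).
have [K4 K4E] : exists K4, K4 = K1 + K2 / g by exists (K1 + K2 / g).
have [q qE] : exists q, q * g = 2 * K.
  by exists (2 * K / g); rewrite divfK // gt_eqF.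
have K40 : 0 <= K4 by rewrite K4E addr_ge0 // divr_ge0 // ltW.
have q0 : 0 <= q by rewrite -(pmulr_lge0 q g0) qE mulr_ge0.
have den : 0 < 1 + K4 + K + q by rewrite !ltr_wpDr.
exists (1 + K4 + K + q)^-1; first by rewrite invr_gt0.
move=> t /andP[t0 td] x.
have td1 : t * (1 + K4 + K + q) <= 1 by rewrite -ler_pdivlMr // mul1r.
have tK4 : 0 <= t * K4 by rewrite mulr_ge0 // ltW.
have tK : 0 <= t * K by rewrite mulr_ge0 // ltW.
have tKg : 0 <= t * q by rewrite mulr_ge0 // ltW.
have t1 : `|t| <= 1 by rewrite (ger0_norm (ltW t0)); lra.
case/memv_addP=> w wW [_ /vlineP[c ->] ->] x0.
rewrite big_ord_recl expr0 mul1r /=.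
under eq_bigr do rewrite exprS -mulrA.
rewrite -mulr_sumr.
have := FK t t1 (w, c) wW; rewrite /N /=; set r := \sum_(i < n) _.
have := FK1 w wW; have := FK2 w wW; set s := F 0 u w + _.
have -> : b (w + c *: u) (w + c *: u) = b w w.
  rewrite [w + _]addrC !(bilin_pl bb, bilin_pr bb) buu (bs w u) (uW w wW).
  by rewrite !(mulr0, add0r).
have -> : F 0 (w + c *: u) (w + c *: u) = c ^+ 2 * g + c * s + F 0 w w.
  by rewrite [w + _]addrC !(bilin_pl (Fb 0), bilin_pr (Fb 0)) /s /g; ring.
have B0 := bW0 w wW.
have Bc : 0 < b w w \/ 0 < c ^+ 2.
  have [w0|w0] := eqVneq w 0; last by left; exact: bW.
  right; rewrite exprn_even_gt0 //; apply: contra_neq x0 => ->.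
  by rewrite w0 scale0r addr0.
set B := b w w in B0 Bc *.
rewrite -expr2 ger0_norm ?sqr_ge0 // => s2.
rewrite !ler_norml => /andP[F0 _] /andP[r0 _].
have c2 := sqr_ge0 c.
have cs : - (g / 2 * c ^+ 2) - K2 / g * B <= c * s.
  have : s ^+ 2 / g <= K2 / g * B by rewrite [leRHS]mulrAC ler_pM2r ?invr_gt0.
  have : 0 <= (g * c / 2 + s) ^+ 2 / g by rewrite divr_ge0 ?sqr_ge0 // ltW.
  have -> : (g * c / 2 + s) ^+ 2 / g = g * c ^+ 2 / 4 + c * s + s ^+ 2 / g.
    by field; rewrite gt_eqF.
  have : 0 <= g * c ^+ 2 by rewrite mulr_ge0 // ltW.
  lra.
have tail : g * c ^+ 2 / 2 - K4 * B - t * (K * (B + c ^+ 2)) <=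
    c ^+ 2 * g + c * s + F 0 w w + t * r.
  have : t * - (K * (B + c ^+ 2)) <= t * r by rewrite ler_pM2l.
  by rewrite mulrN K4E mulrDl; move: cs F0; lra.
have main : 0 < B * (1 - t * (K4 + t * K)) + t * c ^+ 2 * (g / 2 - t * K).
  have P1 : 0 < 1 - t * (K4 + t * K).
    have : t * (t * K) <= t * K.
      by rewrite ler_piMl // (le_trans (ler_norm t)).
    move: td1 t0 tKg; lra.
  have P2 : 0 < g / 2 - t * K.
    have : t * q * g = 2 * (t * K) by rewrite -mulrA qE mulrCA.
    have : t * q * g < 1 * g by rewrite ltr_pM2r //; move: td1 t0 tK tK4; lra.
    lra.
  case: Bc => [Bp|cp].
    by rewrite ltr_pwDl ?mulr_gt0 // mulr_ge0 ?(ltW P2) // mulr_ge0 ?(ltW t0).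
  by apply: ltr_wpDl; [rewrite mulr_ge0 ?(ltW P1)|rewrite mulr_gt0 ?(mulr_gt0 t0)].
apply: lt_le_trans main _.
have := ler_wpM2l (ltW t0) tail; lra.
Qed.

(** If [W] is a negative subspace of maximal dimension, a vector orthogonal to
    [W] on which [b] is negative could be added to [W]; hence [b] is
    semidefinite on the orthogonal complement, and a null vector there is in the
    radical by the Cauchy-Schwarz argument. *)
Lemma orthogonal_posdef b W E : bilin b -> (forall u v, b u v = b v u) ->
  (forall u, u \in E -> (forall v, v \in E -> b u v = 0) -> u = 0) ->
  (W <= E)%VS -> posdef (fun u v => - b u v) W ->
  (forall W', (W' <= E)%VS -> posdef (fun u v => - b u v) W' ->
    (\dim W' <= \dim W)%N) ->
  forall u, u \in E -> (forall w, w \in W -> b u w = 0) -> u != 0 -> 0 < b u u.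
Proof.
move=> bb bs bE WE bW Wmax.
have ge0 u : u \in E -> (forall w, w \in W -> b u w = 0) -> 0 <= b u u.
  move=> uE uW; rewrite leNgt; apply/negP => bu.
  have uW' : u \notin W.
    by apply/negP => /uW bu0; move: bu; rewrite bu0 ltxx.
  have u0 : u != 0 by apply: contraNneq uW' => ->; rewrite mem0v.
  have W'E : (W + <[u]> <= E)%VS by rewrite subv_add WE -memvE.
  suff W'neg : posdef (fun u v => - b u v) (W + <[u]>)%VS.
    by have := Wmax _ W'E W'neg; rewrite dim_add_line // ltnn.
  move=> x /memv_addP[w wW [_ /vlineP[c ->] ->]] x0.
  rewrite [w + _]addrC !(bilin_pl bb, bilin_pr bb) (bs w u) (uW w wW).
  rewrite !(mulr0, addr0, add0r) mulrA -expr2.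
  have [c0|c0] := eqVneq c 0.
    rewrite c0 expr0n mul0r add0r bW //.
    by apply: contra_neq x0 => ->; rewrite c0 scale0r addr0.
  have c2 : 0 < c ^+ 2 by rewrite exprn_even_gt0.
  have : 0 < c ^+ 2 * - b u u by rewrite mulr_gt0 ?oppr_gt0.
  have : 0 <= - b w w.
    by have [->|w0] := eqVneq w 0; [rewrite bilin0l ?oppr0|rewrite ltW ?bW].
  lra.
move=> u uE uW u0; rewrite lt_neqAle ge0 // andbT eq_sym.
apply: contra_neq u0 => bu0; apply: bE => // x xE.
have [U [UE dimU memU]] := orthogonal_complement W E bb.
have UWE : (U + W)%VS = E.
  apply/eqP; rewrite -(dimv_leqif_eq (_ : U + W <= E)%VS) ?subv_add ?UE //.
  rewrite eqn_leq dimvS ?subv_add ?UE //= dimv_disjoint_sum //.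
  apply/eqP; rewrite -subv0; apply/subvP => y /memv_capP[yU yW].
  rewrite memv0; apply: contraT => y0; have := bW y yW y0.
  move: yU; rewrite memU ?(subvP WE) // => /asboolP/(_ _ yW) ->.
  by rewrite oppr0 ltxx.
move: xE; rewrite -UWE => /memv_addP[y yU [w wW ->]].
rewrite bilinDr // (uW w wW) addr0.
have yE := subvP UE _ yU.
have yW : forall w, w \in W -> b y w = 0 by move: yU; rewrite memU // => /asboolP.
apply/eqP; apply: contraT => buy.
(* at this [t] the affine function [t |-> b (t u + y) (t u + y)] equals -1 *)
pose t := - (b y y + 1) / (2 * b u y).
have tuE : t *: u + y \in E by rewrite memvD ?memvZ.
have tuW v : v \in W -> b (t *: u + y) v = 0.
  by move=> vW; rewrite bilin_pl // uW // yW // mulr0 addr0.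
have := ge0 _ tuE tuW.
rewrite !(bilin_pl bb, bilin_pr bb) (bs y u) bu0 mulr0 add0r.
have -> : t * b u y + (t * b u y + b y y) = -1.
  by rewrite /t; field.
by rewrite ler0N1.
Qed.

Lemma eq_posdef b h U : (forall u, u \in U -> b u u = h u u) ->
  posdef b U -> posdef h U.
Proof. by move=> bh bU u uU; rewrite -bh //; exact: bU. Qed.

Lemma posdef_orthogonal_sum b U W : bilin b ->
  (forall u w, u \in U -> w \in W -> b u w = 0 /\ b w u = 0) ->
  posdef b U -> posdef b W ->
  posdef b (U + W)%VS /\ \dim (U + W) = (\dim U + \dim W)%N.
Proof.
move=> bb UW bU bW; split.
  move=> x /memv_addP[u uU [w wW ->]] x0; have [uw wu] := UW u w uU wW.
  rewrite !(bilinDl bb, bilinDr bb) uw wu addr0 add0r.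
  have [u0|u0] := eqVneq u 0.
    move: x0; rewrite u0 add0r => w0; rewrite (bilin0l bb) add0r; exact: bW.
  have [w0|w0] := eqVneq w 0; first by rewrite w0 (bilin0l bb) addr0; exact: bU.
  exact: addr_gt0 (bU u uU u0) (bW w wW w0).
apply: dimv_disjoint_sum; apply/eqP; rewrite -subv0; apply/subvP => x.
rewrite memv_cap memv0 => /andP[xU xW]; apply: contraT => x0.
by have := bU x xU x0; rewrite (UW x x xU xW).1 ltxx.
Qed.

Lemma full_index_nondegenerate b U W E : bilin b ->
  (forall u v, b u v = b v u) -> (U <= E)%VS -> (W <= E)%VS ->
  posdef b U -> posdef (fun u v => - b u v) W ->
  (\dim E <= \dim U + \dim W)%N ->
  forall u, u \in E -> (forall v, v \in E -> b u v = 0) -> u = 0.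
Proof.
move=> bb bs UE WE bU bW dimE.
have UWE : (U + W)%VS = E.
  apply/eqP; rewrite -(dimv_leqif_eq (_ : U + W <= E)%VS) ?subv_add ?UE //.
  rewrite eqn_leq dimvS ?subv_add ?UE //= dimv_disjoint_sum //.
  exact: definite_cap bU bW.
move=> u; rewrite -{1}UWE => /memv_addP[y yU [z zW ->]] rad.
have := rad y (subvP UE _ yU); have := rad z (subvP WE _ zW).
rewrite !(bilinDl bb) (bs z y) => yz yy.
have [y0|y0] := eqVneq y 0.
  have [z0|z0] := eqVneq z 0; first by rewrite y0 z0 addr0.
  by have := bW z zW z0; move: yz; rewrite y0 (bilin0l bb); clear; move=> *; exfalso; lra.
have := bU y yU y0; have [z0|z0] := eqVneq z 0.
  by move: yy; rewrite z0 (bilin0r bb); clear; move=> *; exfalso; lra.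
by move: (bW z zW z0) yy yz; clear; move=> *; exfalso; lra.
Qed.

End RealForms.

(** Connectedness of the unit interval, run from 1 down to 0: the supremum of
    the set where [P] fails can neither satisfy [P] nor fail it. *)
Lemma interval_induction (R : realType) (P : R -> Prop) : P 1 ->
  (forall t, 0 <= t <= 1 -> P t ->
     exists2 d, 0 < d & forall t', `|t' - t| <= d -> P t') ->
  (forall t, 0 <= t < 1 -> (forall t', t < t' <= 1 -> P t') -> P t) ->
  P 0.
Proof.
move=> P1 Popen Pclosed; apply: contrapT => nP0.
pose B := [set t : R | 0 <= t <= 1 /\ ~ P t]%classic.
have B0 : B 0 by split; rewrite ?lexx ?ler01.
have ubB : has_ubound B by exists 1 => t [/andP[]].
have supB : has_sup B by split=> //; exists 0.
set s := sup B.
have s0 : 0 <= s by apply: ub_le_sup.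
have s1 : s <= 1 by apply: ge_sup; [exists 0|move=> t [/andP[]]].
have nPs : ~ P s.
  move=> Ps; have [d d0 dP] := Popen s (introT andP (conj s0 s1)) Ps.
  have [t Bt] := sup_adherent d0 supB; rewrite -/s => st.
  have ts : t <= s by apply: ub_le_sup.
  by case: Bt => _; apply; apply: dP; rewrite ler_norml; apply/andP; split; lra.
have s_lt1 : s < 1.
  by rewrite lt_neqAle s1 andbT; apply: contra_notN nPs => /eqP ->.
apply: nPs; apply: Pclosed; first by rewrite s0.
move=> t /andP[st t1]; apply: contrapT => nPt.
have : t <= s by apply: ub_le_sup => //; split=> //; lra.
by rewrite leNgt st.
Qed.

(** * The mixed Lefschetz theorem along one chain of Hodge types *)

(** The section isolates what the proof needs.  [E i] stands for the component
    of type [(p + i, q + i)], seen as a real space, of degree [e + 2 i] for the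
    grading.  Because [e] is 0 or 1, every degree at least 2 belongs to some
    [E i.+1], and the degree can still be lowered by two inside the chain.  [L]
    is the space of operators, acting by [act]. *)
Section MixedLefschetz.
Variables (R : realType) (X : vectType R) (L : lmodType R).
Variables (act : L -> X -> X) (C : set L) (N0 : L).
Variables (K : X -> X -> R) (e : nat) (E : nat -> {vspace X}).

Hypothesis act_linearl : forall a A B u, act (a *: A + B) u = a *: act A u + act B u.
Hypothesis act_linearr : forall A, linear (act A).
Hypothesis C_convex : convex_cone C.
Hypothesis C_comm : forall A B u, C A -> C B -> act A (act B u) = act B (act A u).
Hypothesis K_bilin : bilin K.
Hypothesis K_skew : forall A u v, C A -> K (act A u) v = - K u (act A v).
Hypothesis e_le1 : (e <= 1)%N.
Hypothesis K_sym : forall u v, K v u = (-1) ^+ e * K u v.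
Hypothesis act_E : forall A i u, C A -> u \in E i.+1 -> act A u \in E i.

Definition word_act (s : seq L) (u : X) := foldr act u s.
Definition word_form s (u v : X) := K u (word_act s v).
Definition word_in (s : seq L) := forall A, A \in s -> C A.

Lemma word_in_cat s s' : word_in s -> word_in s' -> word_in (s ++ s').
Proof. by move=> Cs Cs' A; rewrite mem_cat => /orP[/Cs|/Cs']. Qed.
Lemma word_in_nseq r A : C A -> word_in (nseq r A).
Proof. by move=> CA B; rewrite mem_nseq => /andP[_ /eqP ->]. Qed.
Lemma word_in_cons A s : word_in (A :: s) -> C A /\ word_in s.
Proof. by move=> Cs; split=> [|B Bs]; apply: Cs; rewrite inE ?eqxx // Bs orbT. Qed.

Lemma actD A u v : act A (u + v) = act A u + act A v.
Proof. by rewrite -{1}[u]scale1r act_linearr scale1r. Qed.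
Lemma act0 A : act A 0 = 0.
Proof. by have := act_linearr A (-1) 0 0; rewrite !scaleN1r oppr0 addr0 addNr. Qed.
Lemma actZ A a u : act A (a *: u) = a *: act A u.
Proof. by rewrite -[a *: u]addr0 act_linearr act0 addr0. Qed.
Lemma act0l u : act 0 u = 0.
Proof. by have := act_linearl (-1) 0 0 u; rewrite !scaleN1r oppr0 addr0 addNr. Qed.
Lemma actZl a A u : act (a *: A) u = a *: act A u.
Proof. by rewrite -[a *: A]addr0 act_linearl act0l addr0. Qed.

Lemma word_act_cat s s' u : word_act (s ++ s') u = word_act s (word_act s' u).
Proof. exact: foldr_cat. Qed.
Lemma word_act_linear s : linear (word_act s).
Proof. by elim: s => [|A s IH] a u v //=; rewrite IH act_linearr. Qed.
Lemma word_act0 s : word_act s 0 = 0.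
Proof. by elim: s => //= A s ->; exact: act0. Qed.

Lemma word_actZ s a u : word_act s (a *: u) = a *: word_act s u.
Proof. by rewrite -[a *: u]addr0 word_act_linear word_act0 addr0. Qed.
Lemma word_act_sum s I (r : seq I) (F : I -> X) :
  word_act s (\sum_(i <- r) F i) = \sum_(i <- r) word_act s (F i).
Proof.
apply: (big_morph (word_act s)) => [u v|]; last exact: word_act0.
by rewrite -{1}[u]scale1r word_act_linear scale1r.
Qed.

Lemma act_word_act A s u : C A -> word_in s ->
  act A (word_act s u) = word_act s (act A u).
Proof.
move=> CA; elim: s => //= B s IH /word_in_cons[CB Cs].
by rewrite C_comm // IH.
Qed.

Lemma K_word_act s u v : word_in s ->
  K (word_act s u) v = (-1) ^+ size s * K u (word_act s v).
Proof.
elim: s u v => [|A s IH] u v Cs; first by rewrite mul1r.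
have [CA {}Cs] := word_in_cons Cs.
by rewrite [LHS]K_skew // IH // exprS mulN1r mulNr /= act_word_act.
Qed.

Lemma word_form_bilin s : bilin (word_form s).
Proof.
split=> [v|u] a x y; rewrite /word_form; first by rewrite bilin_pl.
by rewrite word_act_linear bilin_pr.
Qed.

(** Moving a word of length [e + 2 i] across [K] gives the sign [(-1) ^+ e],
    which is the parity of [K]. *)
Lemma word_form_sym s i : word_in s -> size s = (e + i.*2)%N ->
  forall u v, word_form s u v = word_form s v u.
Proof.
move=> Cs sz u v; rewrite /word_form [RHS]K_sym K_word_act // sz mulrA -exprD.
by rewrite addnA addnn -doubleD -muln2 exprM sqrr_sign mul1r.
Qed.

(** The coefficient of [t ^+ i] in [(A + t B) ^ r]. *)
Fixpoint expansion A B r i (u : X) : X :=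
  if r is r'.+1 then
    act A (expansion A B r' i u) +
    (if i is i'.+1 then act B (expansion A B r' i' u) else 0)
  else if i is 0 then u else 0.

Lemma expansion_linear A B r i : linear (expansion A B r i).
Proof.
elim: r i => [|r IH] [|i] a u v //=; rewrite ?scaler0 ?addr0 //.
  by rewrite IH act_linearr.
by rewrite !IH !act_linearr scalerDr addrACA.
Qed.

Lemma expansion_gt A B r i u : (r < i)%N -> expansion A B r i u = 0.
Proof.
by elim: r i => [|r IH] [|i] //= ri; rewrite !IH ?act0 ?addr0 // ltnW.
Qed.

Lemma expansion0 A B r u : expansion A B r 0 u = word_act (nseq r A) u.
Proof. by elim: r => //= r ->; rewrite addr0. Qed.

Lemma expansion1 A B r u : C A -> C B ->
  expansion A B r.+1 1 u = r.+1%:R *: act B (word_act (nseq r A) u).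
Proof.
move=> CA CB; elim: r => [|r IH]; first by rewrite /= act0 add0r scale1r.
rewrite -[LHS]/(act A (expansion A B r.+1 1 u) + act B (expansion A B r.+1 0 u)).
rewrite IH expansion0 actZ C_comm // -[X in _ + X]scale1r.
by rewrite -[act A (word_act (nseq r A) u)]/(word_act (nseq r.+1 A) u) -scalerDl natr1.
Qed.

Lemma act_sum A I (r : seq I) (F : I -> X) :
  act A (\sum_(i <- r) F i) = \sum_(i <- r) act A (F i).
Proof. by apply: (big_morph (act A)) => [u v|]; rewrite ?actD ?act0. Qed.

Lemma word_act_expansion A B r t u :
  word_act (nseq r (A + t *: B)) u = \sum_(i < r.+1) t ^+ i *: expansion A B r i u.
Proof.
elim: r => [|r IH]; first by rewrite big_ord1 scale1r.
rewrite -[LHS]/(act (A + t *: B) (word_act (nseq r (A + t *: B)) u)) IH.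
rewrite addrC act_linearl !act_sum scaler_sumr.
rewrite [RHS]big_ord_recl /= scale1r addr0.
under [in RHS]eq_bigr do rewrite scalerDr.
rewrite big_split /= addrA addrC; congr (_ + _).
  by apply: eq_bigr => i _; rewrite actZ scalerA -exprS.
rewrite [LHS]big_ord_recl [in RHS]big_ord_recr /=.
rewrite (@expansion_gt A B r (bump 0 r)) // act0 scaler0 addr0 expr0 scale1r.
congr (_ + _).
by apply: eq_bigr => i _; rewrite actZ.
Qed.

Definition expansion_form s A B r i u v := K u (word_act s (expansion A B r i v)).

Lemma expansion_form_bilin s A B r i : bilin (expansion_form s A B r i).
Proof.
split=> [v|u] a x y; rewrite /expansion_form; first by rewrite bilin_pl.
by rewrite expansion_linear word_act_linear bilin_pr.
Qed.

Lemma word_form_expansion s A B r t u v :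
  word_form (s ++ nseq r (A + t *: B)) u v = word_form (s ++ nseq r A) u v +
    t * \sum_(i < r) t ^+ i * expansion_form s A B r i.+1 u v.
Proof.
rewrite /word_form !word_act_cat word_act_expansion big_ord_recl scale1r expansion0.
have -> : \sum_(i < r) t ^+ bump 0 i *: expansion A B r (bump 0 i) v =
    t *: \sum_(i < r) t ^+ i *: expansion A B r i.+1 v.
  by rewrite scaler_sumr; apply: eq_bigr => i _; rewrite scalerA -exprS.
rewrite addrC word_act_linear bilin_pr // addrC; congr (_ + _ * _).
rewrite word_act_sum; under eq_bigr do rewrite word_actZ.
elim/big_rec2: _ => [|i y x _ <-]; first exact: bilin0r.
by rewrite bilin_pr.
Qed.

Lemma word_form_scale s c A r u v :
  word_form (s ++ nseq r (c *: A)) u v = c ^+ r * word_form (s ++ nseq r A) u v.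
Proof.
rewrite /word_form !word_act_cat.
have -> : word_act (nseq r (c *: A)) v = c ^+ r *: word_act (nseq r A) v.
  elim: r => [|r IH]; first by rewrite scale1r.
  rewrite -[LHS]/(act (c *: A) (word_act (nseq r (c *: A)) v)) IH.
  by rewrite actZl actZ scalerA -exprS.
by rewrite word_actZ bilinZr.
Qed.

Lemma word_form_open s r A B i a U : C A -> word_in s -> (size s + r = e + i.*2)%N ->
  posdef (fun u v => a * word_form (s ++ nseq r A) u v) U ->
  exists2 d, 0 < d & forall t, `|t| <= d ->
    posdef (fun u v => a * word_form (s ++ nseq r (A + t *: B)) u v) U.
Proof.
move=> CA Cs sz AU.
pose F i u v := a * expansion_form s A B r i.+1 u v.
have Fb j : bilin (F j).
  have Eb := expansion_form_bilin s A B r j.+1.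
  by split=> [v|u] c x y; rewrite /F /= ?(bilin_pl Eb) ?(bilin_pr Eb); ring.
have wb : bilin (fun u v => a * word_form (s ++ nseq r A) u v).
  have wb := word_form_bilin (s ++ nseq r A).
  by split=> [v|u] c x y; rewrite /= ?(bilin_pl wb) ?(bilin_pr wb); ring.
have ws u v : a * word_form (s ++ nseq r A) u v = a * word_form (s ++ nseq r A) v u.
  congr (_ * _); apply: (@word_form_sym _ i); last by rewrite size_cat size_nseq.
  exact/word_in_cat/word_in_nseq.
have [d d0 dP] := posdef_open r wb ws Fb AU.
exists d => // t /dP; apply: eq_posdef => u _.
rewrite word_form_expansion mulrDr [a * (t * _)]mulrCA [a * \sum_(_ < _) _]mulr_sumr.
by congr (_ + _ * _); apply: eq_bigr => j _; rewrite mulrCA.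
Qed.


Variable M : nat.
Hypothesis E_top : forall i, (M <= i)%N -> E i = 0%VS.
Hypothesis N0C : C N0.
Hypothesis C_lefschetz : forall A i u, C A -> u \in E i ->
  word_act (nseq (e + i.*2) A) u = 0 -> u = 0.
Hypothesis C_onto : forall A i u, C A -> u \in E i ->
  exists2 x, x \in E i &
    word_act (nseq (e + i.*2) A) u = word_act (nseq (e + i.*2) N0) x.
Hypothesis N0_onto : forall i u, u \in E i -> exists2 x, x \in E i.+1 &
  word_act (nseq (e + i.*2).+1 N0) u = word_act (nseq (e + i.*2).+2 N0) x.
Hypothesis N0_hodge_riemann : forall i u, u \in E i -> u != 0 ->
  word_act (nseq (e + i.*2).+1 N0) u = 0 -> 0 < word_form (nseq (e + i.*2) N0) u u.

Lemma act_inj A i u : C A -> (0 < e + i.*2)%N -> u \in E i -> act A u = 0 -> u = 0.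
Proof.
move=> CA; case De: (e + i.*2)%N => [//|l] _ uE Au.
apply: (C_lefschetz CA uE); rewrite De -addn1 nseqD word_act_cat /=.
by rewrite Au word_act0.
Qed.

Lemma act_lfun A : exists f : 'Hom(X, X), forall u, f u = act A u.
Proof. by apply: linear_lfun => a u v; rewrite act_linearr. Qed.

Lemma act_image A i (U : {vspace X}) : C A -> (U <= E i.+1)%VS ->
  exists2 W, (W <= E i)%VS & \dim W = \dim U /\
    (forall w, w \in W -> exists2 u, u \in U & w = act A u).
Proof.
move=> CA UE; have [f fE] := act_lfun A; exists (f @: U)%VS.
  by apply/subvP => _ /memv_imgP[u uU ->]; rewrite fE act_E // (subvP UE).
split=> [|_ /memv_imgP[u uU ->]]; last by exists u.
apply: limg_dim_eq; apply/eqP; rewrite -subv0; apply/subvP => u.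
rewrite memv_cap memv_ker fE memv0 => /andP[uU /eqP Au].
by apply/eqP; apply: (act_inj CA _ (subvP UE _ uU) Au); rewrite addnS.
Qed.

(** The expected negative index on [E i] is
    [dim E_(i+1) - dim E_(i+2) + dim E_(i+3) - ...]; the fuel [M - i] reaches the
    degrees where [E] vanishes. *)
Fixpoint alternating_dim (fuel i : nat) : nat :=
  if fuel is f.+1 then (\dim (E i.+1) - alternating_dim f i.+1)%N else 0%N.
Definition neg_index i := alternating_dim (M - i) i.

Lemma neg_index_rec i : (neg_index i + neg_index i.+1)%N = \dim (E i.+1).
Proof.
have rec k : neg_index k = (\dim (E k.+1) - neg_index k.+1)%N.
  rewrite /neg_index; have [kM|Mk] := ltnP k M; first by rewrite -(subnSK kM).
  have -> : (M - k = 0)%N by apply/eqP; rewrite subn_eq0.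
  by rewrite (E_top (leqW Mk)) dimv0.
rewrite (rec i) subnK // (rec i.+1) (leq_trans (leq_subr _ _)) //.
have [W WE [<- _]] := act_image N0C (subvv (E i.+2)).
exact: dimvS.
Qed.

(** A word has the expected signature on [E i] when it has both a [pos_part] and
    a [neg_part]: together they leave no room for a radical. *)
Definition pos_part s i := exists2 U, (U <= E i)%VS &
  (\dim (E i) <= \dim U + neg_index i)%N /\ posdef (word_form s) U.
Definition neg_part s i := exists2 W, (W <= E i)%VS &
  (neg_index i <= \dim W)%N /\ posdef (fun u v => - word_form s u v) W.

(** [A] maps [E i.+1] into [E i] injectively and reverses signs: the form of [s]
    at [act A u] is minus the form of [s A A] at [u].  So the positive part one
    step up always supplies the expected negative part, whatever happens to the
    form of [s] elsewhere. *)
Lemma neg_part_image s A i : C A -> word_in s -> pos_part (s ++ [:: A; A]) i.+1 ->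
  exists2 W, (W <= E i)%VS & [/\ (neg_index i <= \dim W)%N,
    posdef (fun u v => - word_form s u v) W &
    forall w, w \in W -> exists2 u, u \in E i.+1 & w = act A u].
Proof.
move=> CA Cs [U UE [dimU sU]].
have [W WE [dimW AW]] := act_image CA UE; exists W => //; split.
- by rewrite dimW -(leq_add2r (neg_index i.+1)) neg_index_rec.
- move=> w /AW[u uU ->] w0.
  have u0 : u != 0 by apply: contraNneq w0 => ->; rewrite act0.
  have := sU u uU u0; rewrite /word_form word_act_cat /= K_skew // opprK.
  by rewrite act_word_act.
- by move=> w /AW[u uU ->]; exists u => //; exact: (subvP UE).
Qed.

Lemma index_nondegenerate s i u : word_in s -> size s = (e + i.*2)%N ->
  pos_part s i -> neg_part s i -> u \in E i ->
  (forall v, v \in E i -> word_form s u v = 0) ->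
  u = 0.
Proof.
move=> Cs sz [U UE [dimU sU]] [W WE [dimW sW]] uE.
apply: (full_index_nondegenerate (word_form_bilin s) (word_form_sym Cs sz)
  UE WE sU sW) => //.
by rewrite (leq_trans dimU) // leq_add2l.
Qed.

Lemma pos_part_neg_max s i W : pos_part s i -> (W <= E i)%VS ->
  posdef (fun u v => - word_form s u v) W -> (\dim W <= neg_index i)%N.
Proof.
move=> [U UE [dimU sU]] WE sW.
by rewrite -(leq_add2l (\dim U)) (leq_trans (index_le_dim UE WE sU sW)).
Qed.

(** The mixed Hodge-Riemann relation: a vector orthogonal to the image of [A] is
    orthogonal to the maximal negative part that lies in this image. *)
Lemma primitive_positive s A i v : C A -> word_in s -> size s = (e + i.*2)%N ->
  pos_part s i -> pos_part (s ++ [:: A; A]) i.+1 -> v \in E i -> v != 0 ->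
  (forall x, x \in E i.+1 -> word_form s v (act A x) = 0) -> 0 < word_form s v v.
Proof.
move=> CA Cs sz sP /(neg_part_image CA Cs)[W WE [dimW sW AW]] vE v0 vA.
apply: (orthogonal_posdef (word_form_bilin s) (word_form_sym Cs sz) _ WE sW) => //.
- move=> u uE; apply: (index_nondegenerate Cs sz sP) => //.
  by exists W.
- by move=> W' W'E sW'; rewrite (leq_trans _ dimW) // (pos_part_neg_max sP).
- by move=> _ /AW[x xE ->]; exact: vA.
Qed.

Definition segment (A0 A1 : L) (t : R) := (1 - t) *: A0 + t *: A1.

Lemma segmentC A0 A1 t : C A0 -> C A1 -> 0 <= t <= 1 -> C (segment A0 A1 t).
Proof.
move=> C0 C1 /andP[t0 t1]; rewrite /segment.
have [->|tn0] := eqVneq t 0; first by rewrite subr0 scale1r scale0r addr0.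
have [->|tn1] := eqVneq t 1; first by rewrite subrr scale1r scale0r add0r.
by apply: C_convex => //; rewrite ?subr_gt0 lt_neqAle ?tn1 // eq_sym tn0.
Qed.

(** The deformation step.  Move [A] along the segment from [A1], where the
    signature is known, to [A0].  The negative index is everywhere at least the
    expected one.  At the first failure the form has a radical vector [u], and
    by the hypothesis on radical vectors its derivative in the direction of [A1]
    is negative at [u]; just before, closer to [A1], the negative index then
    exceeds the expected one, which contradicts the positive part there. *)
Lemma pos_part_segment s r i A0 A1 : C A0 -> C A1 -> word_in s ->
  (size s + r = e + i.*2)%N ->
  (forall A, C A -> neg_part (s ++ nseq r A) i) ->
  (forall A u, C A -> u \in E i -> u != 0 ->
    (forall v, v \in E i -> word_form (s ++ nseq r A) u v = 0) ->
    exists2 r', r = r'.+1 & word_form (s ++ A1 :: nseq r' A) u u < 0) ->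
  pos_part (s ++ nseq r A1) i -> pos_part (s ++ nseq r A0) i.
Proof.
move=> C0 C1 Cs sz negA rad pos1.
have szw A : size (s ++ nseq r A) = (e + i.*2)%N by rewrite size_cat size_nseq.
have Cw A : C A -> word_in (s ++ nseq r A) by move=> CA; exact/word_in_cat/word_in_nseq.
have seg0 : segment A0 A1 0 = A0 by rewrite /segment subr0 scale1r scale0r addr0.
have seg1 : segment A0 A1 1 = A1 by rewrite /segment subrr scale1r scale0r add0r.
(* the direction [A1 - A0] need not be in the cone: openness holds for any *)
have segD t t' : segment A0 A1 t' = segment A0 A1 t + (t' - t) *: (A1 - A0).
  rewrite /segment !scalerBl !scalerBr !scale1r.
  rewrite opprB [X in _ = _ + X]addrC addrA.
  by rewrite [X in _ = X + _]addrACA subrK subrr addr0 [X in _ = _ + X]addrC addrA.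
rewrite -seg0.
apply: (interval_induction (P := fun t => pos_part (s ++ nseq r (segment A0 A1 t)) i)).
- by rewrite seg1.
- move=> t t01 [U UE [dimU sU]].
  have Ct := segmentC C0 C1 t01.
  have [|d d0 dP] := @word_form_open s r _ (A1 - A0) i 1 U Ct Cs sz.
    by apply: eq_posdef sU => u _; rewrite mul1r.
  exists d => // t' tt'; exists U => //; split=> //.
  by rewrite (segD t); apply: eq_posdef (dP _ tt') => u _; rewrite mul1r.
move=> t /andP[t0 t1] Pt.
have Ct : C (segment A0 A1 t) by apply: segmentC => //; rewrite t0 ltW.
set A := segment A0 A1 t in Ct *.
have [W WE [dimW sW]] := negA A Ct.
have wb := word_form_bilin (s ++ nseq r A).
have ws := word_form_sym (Cw A Ct) (szw A).
have Wmax W' : (W' <= E i)%VS ->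
    posdef (fun u v => - word_form (s ++ nseq r A) u v) W' -> (\dim W' <= neg_index i)%N.
  move=> W'E sW'.
  have [|d d0 dP] := @word_form_open s r A (A1 - A0) i (-1) W' Ct Cs sz.
    by apply: eq_posdef sW' => u _; rewrite mulN1r.
  pose h := Num.min d (1 - t).
  have h0 : 0 < h by rewrite lt_min d0 subr_gt0.
  have hd : h <= d by rewrite ge_min lexx.
  have h1 : h <= 1 - t by rewrite ge_min lexx orbT.
  apply: (@pos_part_neg_max (s ++ nseq r (segment A0 A1 (t + h)))) => //.
    by apply: Pt; lra.
  rewrite (segD t) [t + h - t]addrAC subrr add0r.
  apply: eq_posdef (dP h _) => [u _|]; first by rewrite mulN1r.
  by rewrite ger0_norm // ltW.
have nondeg u : u \in E i ->
    (forall v, v \in E i -> word_form (s ++ nseq r A) u v = 0) -> u = 0.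
  move=> uE urad; apply/eqP; apply: contraT => u0.
  have [r' rE neg] := rad A u Ct uE u0 urad; exfalso.
  pose b u v := - word_form (s ++ nseq r A) u v.
  have bb : bilin b.
    by split=> [v|v] c x y; rewrite /b /= ?(bilin_pl wb) ?(bilin_pr wb); ring.
  have bs x y : b x y = b y x by rewrite /b ws.
  pose F j x y := - expansion_form s A A1 r j.+1 x y.
  have Fb j : bilin (F j).
    have Eb := expansion_form_bilin s A A1 r j.+1.
    by split=> [v|v] c x y; rewrite /F /= ?(bilin_pl Eb) ?(bilin_pr Eb); ring.
  have bu v : v \in E i -> b u v = 0 by move=> vE; rewrite /b urad ?oppr0.
  have [|||d d0 dP] := @posdef_crossing _ _ b W u F r' bb bs Fb sW.
  - by move=> w wW; rewrite bu // (subvP WE).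
  - exact: bu.
  - rewrite /F /expansion_form rE expansion1 // word_actZ bilinZr // -mulrN mulr_gt0 //.
    by rewrite oppr_gt0; move: neg; rewrite /word_form word_act_cat.
  pose h := Num.min d (1 - t).
  have h0 : 0 < h by rewrite lt_min d0 subr_gt0.
  have hd : h <= d by rewrite ge_min lexx.
  have h1 : h <= 1 - t by rewrite ge_min lexx orbT.
  have h1p : 0 < 1 + h by lra.
  (* up to the factor [1 + h], adding [h A1] moves along the segment to [A1] *)
  pose t' := (t + h) / (1 + h).
  have AE : A + h *: A1 = (1 + h) *: segment A0 A1 t'.
    rewrite /segment scalerDr !scalerA /A /segment -addrA -scalerDl.
    by congr (_ *: _ + _ *: _); rewrite /t'; field; rewrite gt_eqF.
  have t't : t < t' <= 1.
    by rewrite /t' ltr_pdivlMr // ler_pdivrMr //; apply/andP; split; nra.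
  have uW : u \notin W.
    apply/negP => uW; have := sW u uW u0.
    by rewrite urad ?oppr0 ?ltxx.
  suff : (\dim (W + <[u]>) <= neg_index i)%N.
    by rewrite dim_add_line // ltnNge dimW.
  apply: (pos_part_neg_max (Pt t' t't)).
    by rewrite subv_add WE -memvE.
  have := dP h; rewrite h0 hd => /(_ isT) sWu x xWu x0.
  have := sWu x xWu x0; rewrite -rE.
  have -> : b x x + h * (\sum_(j < r) h ^+ j * F j x x) =
      - word_form (s ++ nseq r (A + h *: A1)) x x.
    rewrite word_form_expansion opprD; congr (_ + _); rewrite -mulrN; congr (_ * _).
    by rewrite -sumrN; apply: eq_bigr => j _; rewrite mulrN.
  by rewrite AE word_form_scale -mulrN pmulr_rgt0 // exprn_gt0.
have [U [UE dimU memU]] := orthogonal_complement W (E i) wb.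
exists U => //; split.
  by rewrite (leq_trans dimU) // leq_add2l Wmax.
move=> u uU u0; have uE := subvP UE _ uU.
apply: (orthogonal_posdef wb ws nondeg WE sW _ uE) => // [W' W'E sW'|].
  exact: leq_trans (Wmax W' W'E sW') dimW.
by move: uU; rewrite memU // => /asboolP.
Qed.

Lemma index_top s i : (M <= i)%N -> pos_part s i /\ neg_part s i.
Proof.
move=> Mi; have ni : neg_index i = 0%N.
  by rewrite /neg_index; have /eqP -> : (M - i == 0)%N by rewrite subn_eq0.
by split; exists 0%VS; rewrite ?sub0v // ?ni ?E_top ?dimv0 //; split=> // u;
  rewrite memv0 => /eqP ->; rewrite eqxx.
Qed.

Lemma word_act_nseqS r A u : word_act (nseq r A) (act A u) = word_act (nseq r.+1 A) u.
Proof. by rewrite -addn1 nseqD word_act_cat. Qed.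

(** [E i] is spanned by the primitive vectors and [N0 E_(i+1)], which are
    orthogonal; the polarization gives positivity on the former, and the
    negative part of [E i.+1] becomes positive under [N0]. *)
Lemma N0_pos_part i : neg_part (nseq (e + i.+1.*2) N0) i.+1 ->
  pos_part (nseq (e + i.*2) N0) i.
Proof.
set l := (e + i.*2)%N; move=> [W WE [dimW sW]].
have Cn r : word_in (nseq r N0) by exact: word_in_nseq.
have [f fE] : exists f : 'Hom(X, X), forall u, f u = word_act (nseq l.+1 N0) u.
  by apply: linear_lfun; exact: word_act_linear.
pose P := (E i :&: lker f)%VS.
have PE : (P <= E i)%VS by exact: capvSl.
have Pf u : u \in P -> word_act (nseq l.+1 N0) u = 0.
  by rewrite memv_cap memv_ker fE => /andP[_ /eqP].
have [NW NWE [dimNW actNW]] := act_image N0C WE.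
have dimE : (\dim (E i) <= \dim P + \dim (E i.+1))%N.
  have [g gE] := act_lfun N0.
  have -> : E i = (P + g @: E i.+1)%VS.
    apply/eqP; rewrite eqEsubv subv_add PE andTb; apply/andP; split; last first.
      by apply/subvP => _ /memv_imgP[x xE ->]; rewrite gE act_E.
    apply/subvP => u uE; have [x xE ux] := N0_onto uE.
    rewrite -[u](subrK (act N0 x)); apply: memv_add; last by rewrite -gE memv_img.
    rewrite memv_cap memvB ?act_E // memv_ker fE -scaleN1r addrC word_act_linear.
    by rewrite word_act_nseqS scaleN1r ux addNr eqxx.
  rewrite (leq_trans (dimv_add_leqif _ _)) // leq_add2l.
  by rewrite -(limg_ker_dim g (E i.+1)) leq_addl.
have PNW p w : p \in P -> w \in NW ->
    word_form (nseq l N0) p w = 0 /\ word_form (nseq l N0) w p = 0.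
  move=> pP /actNW[x xW ->].
  have pw : word_form (nseq l N0) p (act N0 x) = 0.
    rewrite /word_form word_act_nseqS; have := K_word_act p x (Cn l.+1).
    rewrite (Pf p pP) (bilin0l K_bilin) => /esym/eqP.
    by rewrite mulf_eq0 signr_eq0 => /eqP.
  by split=> //; rewrite (@word_form_sym _ i) // size_nseq.
have [||sPW dimPW] := posdef_orthogonal_sum (word_form_bilin (nseq l N0)) PNW.
- move=> u uP u0; apply: N0_hodge_riemann => //; first exact: (subvP PE).
  exact: Pf.
- move=> w /actNW[x xW ->] w0.
  have x0 : x != 0 by apply: contraNneq w0 => ->; rewrite act0.
  have := sW x xW x0; rewrite /word_form doubleS !addnS -/l word_act_nseqS.
  by rewrite K_skew //.
exists (P + NW)%VS; first by rewrite subv_add PE.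
split=> //; rewrite dimPW dimNW -addnA.
rewrite (leq_trans dimE) // leq_add2l -(neg_index_rec i) addnC leq_add2r.
by rewrite dimW.
Qed.

(** For powers of a single [A] the deformation to [N0] meets no radical vector,
    by the Lefschetz property of every element of the cone. *)
Lemma power_index i A : C A ->
  pos_part (nseq (e + i.*2) A) i /\ neg_part (nseq (e + i.*2) A) i.
Proof.
have [d] := ubnP (M - i); elim: d i A => // d IH i A dM CA.
have [Mi|iM] := leqP M i; first exact: index_top.
have IH' B : C B -> pos_part (nseq (e + i.+1.*2) B) i.+1 /\
    neg_part (nseq (e + i.+1.*2) B) i.+1.
  by apply: IH; rewrite -ltnS (leq_trans _ dM) // ltnS -(subnSK iM).
have neg B : C B -> neg_part (nseq (e + i.*2) B) i.
  move=> CB; have [|W WE [dimW sW _]] :=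
    @neg_part_image (nseq (e + i.*2) B) B i CB (word_in_nseq CB).
    have [+ _] := IH' B CB; rewrite doubleS !addnS -addn2 nseqD.
    by [].
  by exists W.
split; last exact: neg.
have N0P : pos_part (nseq (e + i.*2) N0) i by apply: N0_pos_part; have [] := IH' N0 N0C.
apply: (@pos_part_segment [::] _ i A N0) => // B u CB uE u0 rad; exfalso.
move/eqP: u0; apply; apply: (C_lefschetz CB uE).
have [x xE ux] := C_onto CB uE; rewrite ux.
suff -> : x = 0 by exact: word_act0.
have Nsz : size (nseq (e + i.*2) N0) = (e + i.*2)%N by rewrite size_nseq.
apply: (index_nondegenerate (word_in_nseq N0C) Nsz N0P (neg N0 N0C) xE) => v vE.
have := rad v vE; rewrite /word_form /=.
have := K_word_act u v (word_in_nseq (r := e + i.*2) CB).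
rewrite ux K_word_act ?size_nseq //.
  by move=> /(mulfI (negbT (signr_eq0 R _))) ->.
exact: word_in_nseq.
Qed.

(** Induction on the length of [s], then downwards on [i].  The word [s T A^r] is
    deformed by moving [A] to [T], where it becomes [s T^(r+1)] with a shorter
    mixed part.  If [u] is a radical vector of [s T A^r], then [T u] is nonzero and
    primitive for [s A^(r-1)], so the Hodge-Riemann relation of that shorter word
    gives the form of [s T T A^(r-1)] a negative value at [u]. *)
Lemma mixed_index s r i A : word_in s -> C A -> (size s + r = e + i.*2)%N ->
  pos_part (s ++ nseq r A) i /\ neg_part (s ++ nseq r A) i.
Proof.
elim/last_ind: s r i A => [|s T IHs] r i A Cs CA.
  by rewrite add0n => ->; exact: power_index.
have CT : C T by apply: Cs; rewrite mem_rcons inE eqxx.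
have {}Cs : word_in s by move=> B Bs; apply: Cs; rewrite mem_rcons inE Bs orbT.
have CsT : word_in (rcons s T).
  by rewrite -cats1; apply: word_in_cat => // B; rewrite inE => /eqP ->.
have [d] := ubnP (M - i); elim: d r i A CA => // d IHd r i A CA dM.
rewrite size_rcons => sz.
have [Mi|iM] := leqP M i; first exact: index_top.
have szT B : C B -> pos_part (rcons s T ++ nseq r.+2 B) i.+1.
  move=> CB; have [||] // := IHd r.+2 i.+1 B CB.
    by rewrite -ltnS (leq_trans _ dM) // ltnS -(subnSK iM).
  by rewrite size_rcons doubleS !addnS sz.
have neg B : C B -> neg_part (rcons s T ++ nseq r B) i.
  move=> CB; have [||W WE [dimW sW _]] := @neg_part_image (rcons s T ++ nseq r B) B i CB.
  - exact/word_in_cat/word_in_nseq.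
  - by have := szT B CB; rewrite -addn2 nseqD catA.
  by exists W.
split; last exact: neg.
case: r sz szT neg => [|r] sz szT neg.
  rewrite cats0 -cats1; have [|] // := IHs 1 i T Cs CT.
  by rewrite addn1 -sz addn0.
apply: (@pos_part_segment (rcons s T) _ i A T) => //; first by rewrite size_rcons.
- move=> B u CB uE u0 rad; exists r => //.
  case: i sz uE {dM iM szT neg} rad => [|i].
    by rewrite addn0 => sz; move: e_le1; rewrite -sz addnS.
  rewrite addnS doubleS !addnS => -[sz] uE rad.
  have Csr : word_in (s ++ nseq r B) by exact/word_in_cat/word_in_nseq.
  have szr : size (s ++ nseq r B) = (e + i.*2)%N.
    by rewrite size_cat size_nseq; case: sz.
  have : 0 < word_form (s ++ nseq r B) (act T u) (act T u).
    apply: (primitive_positive CB Csr szr).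
    - by have [] := IHs r i B Cs CB; rewrite // -szr size_cat size_nseq.
    - rewrite -catA -(nseqD r 2); have [] // := IHs (r + 2)%N i.+1 B Cs CB.
      by rewrite doubleS !addnS addn0 -szr size_cat size_nseq.
    - exact: act_E.
    - apply: contra_neq u0; apply: (act_inj CT _ uE); by rewrite doubleS !addnS.
    - move=> x xE; have := rad x xE.
      rewrite /word_form K_skew // cat_rcons !word_act_cat -[T :: _]cat1s word_act_cat.
      by rewrite act_word_act //= word_act_nseqS => ->; rewrite oppr0.
  rewrite /word_form K_skew // oppr_gt0.
  rewrite act_word_act // !word_act_cat -cats1 word_act_cat /=.
  by rewrite !act_word_act //; exact: word_in_nseq.
- rewrite cat_rcons; have [|] // := IHs r.+2 i T Cs CT.
  by rewrite !addnS -sz addSn addnS.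
Qed.

Lemma mixed_injective s i u : word_in s -> size s = (e + i.*2)%N -> u \in E i ->
  word_act s u = 0 -> u = 0.
Proof.
move=> Cs sz uE su.
have [|sP sN] := mixed_index (r := 0) (i := i) Cs N0C; first by rewrite addn0.
rewrite cats0 in sP sN.
apply: (index_nondegenerate Cs sz sP sN uE) => v vE.
have := K_word_act u v Cs; rewrite su (bilin0l K_bilin) => /esym/eqP.
by rewrite mulf_eq0 signr_eq0 => /eqP.
Qed.

End MixedLefschetz.

(** * Direct sum decompositions indexed by an arbitrary type *)

Section DirectSums.
Variables (F : fieldType) (W : vectType F) (I : eqType).
Variables (U : I -> {vspace W}) (X : {vspace W}).
Hypothesis dU : direct_sum_decomposition U X.

Lemma direct_sum_mem x : x \in X -> exists (s : seq I) (f : I -> W),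
  [/\ uniq s, forall i, f i \in U i & x = \sum_(i <- s) f i].
Proof.
have mem_sum (s : seq I) y : uniq s -> y \in (\sum_(i <- s) U i)%VS ->
    exists2 f : I -> W, forall i, f i \in U i & y = \sum_(i <- s) f i.
  elim: s y => [|j s IH] y /=.
    rewrite big_nil memv0 => _ /eqP ->.
    by exists (fun=> 0) => [i|]; rewrite ?mem0v // big_nil.
  case/andP=> js us; rewrite big_cons => /memv_addP[z zU [t /(IH _ us)[f fU ->] ->]].
  exists (fun i => if i == j then z else f i) => [i|].
    by case: eqP => [->|].
  rewrite big_cons eqxx; congr (_ + _); apply: eq_big_seq => i si.
  by case: eqP js => // <-; rewrite si.
move=> xX; have [_ _ [s Xs]] := dU.
have [|f fU fE] := mem_sum (undup s) x (undup_uniq s).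
  apply: (subvP _ x xX); apply: subv_trans Xs _; elim: s => [|j s IH] /=.
    by rewrite big_nil sub0v.
  rewrite big_cons subv_add; case: ifP => [js|_].
    rewrite IH andbT (big_rem j) ?mem_undup //=; exact: addvSl.
  by rewrite big_cons addvSl (subv_trans IH) ?addvSr.
by exists (undup s), f; split=> //; exact: undup_uniq.
Qed.

Lemma direct_sum_zero (s : seq I) (f : I -> W) : uniq s ->
  (forall i, f i \in U i) -> \sum_(i <- s) f i = 0 ->
  forall i, i \in s -> f i = 0.
Proof.
move=> us fU; have [_ dir _] := dU.
have {dir} : \dim (\sum_(i <- s) U i)%VS = (\sum_(i <- s) \dim (U i))%N.
  by have /directvP := dir s us.
elim: s us => //= j s IH /andP[js us]; rewrite !big_cons => dimE fs i.
have dims := dimv_leq_sum s xpredT U.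
have dimUs : \dim (\sum_(i <- s) U i)%VS = (\sum_(i <- s) \dim (U i))%N.
  apply/eqP; rewrite eqn_leq dims -(leq_add2l (\dim (U j))) -dimE.
  exact: dimv_add_leqif.
have U0 : (U j :&: \sum_(i <- s) U i)%VS = 0%VS.
  by apply/eqP; rewrite -subv0 -(dimv_add_leqif _ _).2 dimE dimUs.
have fj0 : f j = 0.
  apply/eqP; rewrite -memv0 -U0 memv_cap fU -memvN.
  move/eqP: fs; rewrite addr_eq0 => /eqP ->; rewrite opprK.
  elim: (s) => [|h t IHt]; first by rewrite !big_nil mem0v.
  by rewrite !big_cons memv_add.
move: fs; rewrite fj0 add0r => fs; rewrite inE => /predU1P[-> //|].
exact: IH.
Qed.

Lemma direct_sum_component (s : seq I) (f : I -> W) j y : uniq s ->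
  (forall i, f i \in U i) -> y \in U j -> y = \sum_(i <- s) f i ->
  y = if j \in s then f j else 0.
Proof.
move=> us fU yU ys.
pose g i := (if i \in s then f i else 0) - (if i == j then y else 0).
have gU i : g i \in U i.
  apply: memvB; first by case: ifP => _; rewrite ?mem0v.
  by case: eqP => [->|_]; rewrite ?mem0v.
have fs : \sum_(i <- s) f i = \sum_(i <- s) (if i \in s then f i else 0).
  by apply: eq_big_seq => i ->.
pose s' := if j \in s then s else j :: s.
have us' : uniq s' by rewrite /s'; case: ifP => //= ->.
have js' : j \in s' by rewrite /s'; case: ifP => //; rewrite inE eqxx.
have sum0 : \sum_(i <- s') g i = 0.
  rewrite sumrB [X in _ - X](bigD1_seq j) //= eqxx.
  rewrite [X in _ - (_ + X)]big1 ?addr0 => [|i /negPf -> //].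
  apply/eqP; rewrite subr_eq0 ys fs /s'; apply/eqP.
  by case: ifP => // js; rewrite big_cons js add0r.
have := direct_sum_zero us' gU sum0 js'.
by rewrite /g eqxx => /eqP; rewrite subr_eq0 eq_sym => /eqP.
Qed.

End DirectSums.

(** * Complexified spaces *)

Section Complexification.
Variables (R : realType) (V : vectType R).
Local Notation VC := (complexification V).
Implicit Types (H : {vspace V}) (w : VC).

Lemma complexify_spaceP H w :
  (w \in complexify_space H) = (w.1 \in H) && (w.2 \in H).
Proof.
pose e := [tuple of [seq of_real x | x <- vbasis H]].
have eE (i : 'I_(\dim H)) : e`_i = of_real (vbasis H)`_i.
  by rewrite (nth_map 0) ?size_tuple.
have sumE I (r : seq I) (f : I -> VC) :
    \sum_(i <- r) f i = (\sum_(i <- r) (f i).1, \sum_(i <- r) (f i).2).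
  elim: r => [|h r IH]; first by rewrite !big_nil.
  by rewrite !big_cons IH.
apply/idP/andP => [wH|[w1 w2]].
  rewrite (coord_span (X := e) wH) sumE /=; split; apply: memv_suml => i _;
    rewrite eE /= scaler0 ?subr0 ?add0r memvZ // vbasis_mem // mem_nth // size_tuple //.
have real_mem x : x \in H -> of_real x \in complexify_space H.
  move=> xH; rewrite (coord_vbasis xH).
  have -> : of_real (\sum_(i < \dim H) coord (vbasis H) i x *: (vbasis H)`_i) =
     \sum_(i < \dim H) (coord (vbasis H) i x)%:C%C *: of_real (vbasis H)`_i.
    rewrite sumE /of_real /=; congr pair.
      by apply: eq_bigr => i _ /=; rewrite scaler0 subr0.
    by rewrite big1 // => i _ /=; rewrite scaler0 scale0r addr0.
  apply: memv_suml => i _; apply: memvZ; apply: memv_span; apply: map_f.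
  by rewrite mem_nth // size_tuple.
have -> : w = of_real w.1 + 'i%C *: of_real w.2.
  case: w {w1 w2} => x y; rewrite /of_real; congr pair => /=.
    by rewrite scale0r scale1r subr0 addr0.
  by rewrite scaler0 scale1r !add0r.
by rewrite memvD ?memvZ ?real_mem.
Qed.

(** Forgetting the complex structure of a subspace: the kernel of the difference
    of a projection and the identity makes sense over both fields. *)
Lemma realify (U : {vspace VC}) :
  exists U' : {vspace (V * V)%type}, forall w : V * V, (w \in U') = ((w : VC) \in U).
Proof.
have [|f fE] := @linear_lfun R (V * V)%type (V * V)%type
    (fun w => (projv U (w : VC) : V * V) - w).
  move=> a u v.
  have -> : (a *: u + v : V * V) = (a%:C%C *: (u : VC) + (v : VC) : VC).
    by case: u v => [x y] [z t]; congr pair => /=; rewrite scale0r ?subr0 ?addr0.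
  rewrite linearP; case: u v => [x y] [z t]; congr pair => /=;
    by rewrite !scale0r !(subr0, addr0) scalerBr opprD addrACA.
exists (lker f) => w; rewrite memv_ker fE subr_eq0; apply/eqP/idP => [<-|wU].
  exact: memv_proj.
exact: (projv_id wU).
Qed.

End Complexification.

(** * Polarized Hodge-Lefschetz modules *)

Section HodgeLefschetzModule.
Variables (R : realType) (V : vectType R) (Vg : int -> {vspace V}).
Variables (k : nat) (Q : {biscalar V}) (a : {vspace 'End(V)}) (N0 : 'End(V)).
Variables (C : set 'End(V)) (Vpq : int -> int -> {vspace complexification V}).
Local Notation VC := (complexification V).
Local Notation X := (V * V)%type.

Hypothesis Hmod : polarized_hodge_lefschetz_module Vg k Q a N0.
Hypothesis Hbig : hodge_lefschetz_bigrading Vg k Q a N0 Vpq.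
Hypothesis Hcone : lefschetz_cone Vg a N0 C.

Definition cact (T : 'End(V)) (w : X) : X := (T w.1, T w.2).
Local Notation cword_act := (word_act cact).

Lemma lfun_powS (N : 'End(V)) n x : lfun_pow N n.+1 x = N (lfun_pow N n x).
Proof. by rewrite -[lfun_pow N n.+1]/(N \o lfun_pow N n)%VF lfunE. Qed.

Lemma cword_act_nseq (N : 'End(V)) n w :
  cword_act (nseq n N) w = (lfun_pow N n w.1, lfun_pow N n w.2).
Proof.
elim: n => [|n IH]; first by rewrite /lfun_pow /= !lfunE; case: w.
by rewrite -[LHS]/(cact N (cword_act (nseq n N) w)) IH /cact /= !lfun_powS.
Qed.

Lemma Vpq_degree (l p q : int) w : p + q = l + k%:Z -> w \in Vpq p q ->
  w.1 \in Vg l /\ w.2 \in Vg l.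
Proof.
move=> pq wpq; have [sub _ _] := bigrading_graded Hbig l.
apply/andP; rewrite -complexify_spaceP; apply: (subvP (sub p)).
by have -> : l + k%:Z - p = q by lia.
Qed.

Lemma cword_act_type (s : seq 'End(V)) (p q : int) w : word_in C s -> w \in Vpq p q ->
  (cword_act s w : VC) \in Vpq (p - (size s)%:Z) (q - (size s)%:Z).
Proof.
have [_ Ca _ _] := Hcone.
elim: s w => [|T s IH] w Cs wpq /=; first by rewrite !subr0.
have [CT Cs'] := word_in_cons Cs.
rewrite -addn1 PoszD !opprD !addrA.
exact: (bigrading_action Hbig (Ca _ CT) (IH w Cs' wpq)).
Qed.

(** [N0 ^ l] is onto on each Hodge type because it is onto on the whole degree
    and shifts types: compare the components of type [(p - l, q - l)]. *)
Lemma N0_power_onto (l : nat) (p q : int) (y : X) : p + q = l%:Z + k%:Z ->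
  (y : VC) \in Vpq (p - l%:Z) (q - l%:Z) ->
  exists2 x : X, (x : VC) \in Vpq p q & cword_act (nseq l N0) x = y.
Proof.
move=> pq ypq; have [_ lef] := phl_lefschetz Hmod.
have [_ Ca CN0 _] := Hcone.
have [_ imN] := lef l.
have [|y1 y2] := @Vpq_degree (- l%:Z) _ _ _ _ ypq; first by lia.
rewrite -imN in y1 y2.
have /memv_imgP[x1 x1V y1E] := y1; have /memv_imgP[x2 x2V y2E] := y2.
have xV : ((x1, x2) : VC) \in complexify_space (Vg l%:Z).
  by rewrite complexify_spaceP x1V x2V.
have [s [f [us fU xs]]] := direct_sum_mem (bigrading_graded Hbig l%:Z) xV.
have yE : y = cword_act (nseq l N0) (x1, x2).
  by rewrite cword_act_nseq -y1E -y2E; case: (y).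
have cword_act_sum (r : seq int) (g : int -> VC) :
    cword_act (nseq l N0) (\sum_(i <- r) g i : VC) =
    (\sum_(i <- r) (cword_act (nseq l N0) (g i) : VC) : VC).
  apply: (big_morph (fun x : VC => cword_act (nseq l N0) x : VC)) => [u v|].
    by rewrite !cword_act_nseq; congr pair; rewrite linearD.
  by rewrite cword_act_nseq; congr pair; rewrite linear0.
pose g (j : int) : VC := cword_act (nseq l N0) (f (j + l%:Z)).
have gU j : g j \in Vpq j (- l%:Z + k%:Z - j).
  have := @cword_act_type (nseq l N0) _ _ _ (word_in_nseq CN0) (fU (j + l%:Z)).
  rewrite size_nseq /g addrK.
  by have -> : l%:Z + k%:Z - (j + l%:Z) - l%:Z = - l%:Z + k%:Z - j by lia.
have yU : (y : VC) \in Vpq (p - l%:Z) (- l%:Z + k%:Z - (p - l%:Z)).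
  by have -> : - l%:Z + k%:Z - (p - l%:Z) = q - l%:Z by lia.
have us' : uniq [seq i - l%:Z | i <- s] by rewrite map_inj_uniq //; exact: addIr.
have ys : (y : VC) = \sum_(j <- [seq i - l%:Z | i <- s]) g j.
  rewrite big_map yE xs cword_act_sum; apply: eq_bigr => i _.
  by rewrite /g subrK.
have := direct_sum_component (bigrading_graded Hbig (- l%:Z)) us' gU yU ys.
case: ifP => _ ->; last first.
  by exists 0; [exact: mem0v | rewrite cword_act_nseq; congr pair; rewrite linear0].
exists (f p); last by rewrite /g subrK.
by have := fU p; have -> : l%:Z + k%:Z - p = q by lia.
Qed.

(** The constant in the polarization of [H^(p, d - p)].  It does not change when
    [p] grows by one and [d] by two, so one form serves a whole chain. *)
Definition sign_unit (p d : int) : R[i] := (-1) ^ p * 'i%C ^ (- d).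

(** On a single Hodge type the real part of the Hermitian form carries the same
    information, and makes real symmetric forms sufficient. *)
Definition real_hodge_form (z : R[i]) (u v : X) : R :=
  complex.Re (z * complexify_form Q u (conjv (v : VC))).

Lemma real_hodge_formE (z : R[i]) (u v : X) : real_hodge_form z u v =
  complex.Re z * (Q u.1 v.1 + Q u.2 v.2) - complex.Im z * (Q u.2 v.1 - Q u.1 v.2).
Proof.
case: z => x y; rewrite /real_hodge_form /complexify_form /= !linearNr.
by rewrite opprK [- _ + _]addrC.
Qed.

Lemma real_hodge_form_bilin z : bilin (real_hodge_form z).
Proof.
split=> [w|w] c u v; rewrite !real_hodge_formE /=.
  by rewrite !linearPl /=; ring.
by rewrite !linearPr /=; ring.
Qed.

Lemma real_hodge_form_skew z T u v : T \in a ->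
  real_hodge_form z (cact T u) v = - real_hodge_form z u (cact T v).
Proof.
move=> /(phl_algebra Hmod)[QT _]; rewrite !real_hodge_formE /=.
have sk x y : Q (T x) y = - Q x (T y) by apply/eqP; rewrite -addr_eq0 QT.
by rewrite !sk; ring.
Qed.

Lemma sign_unit_conj p d : ((sign_unit p d)^*)%C = (-1) ^ d * sign_unit p d.
Proof.
have iN : (('i%C : R[i])^*)%C = -1 * 'i%C.
  by rewrite mulN1r; apply/eqP; rewrite eq_complex /= oppr0 !eqxx.
have JM (x y : R[i]) : ((x * y)^*)%C = (x^*)%C * (y^*)%C by exact: rmorphM.
have JX (x : R[i]) n : ((x ^ n)^*)%C = (x^*)%C ^ n by exact: fmorphXz.
have J1 : (((-1) : R[i])^*)%C = -1 by exact: rmorphN1.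
rewrite /sign_unit JM !JX J1 iN expfzMl mulrCA; congr (_ * _).
by rewrite -exprz_inv invrN1.
Qed.

Lemma sign_unit_shift p d (i : nat) :
  sign_unit (p + i%:Z) (d + i.*2%:Z) = sign_unit p d.
Proof.
have i0 : ('i%C : R[i]) != 0 by rewrite eq_complex /= oner_eq0 andbF.
have N0' : (-1 : R[i]) != 0 by rewrite oppr_eq0 oner_eq0.
have i2 : ('i%C : R[i]) ^ (- i.*2%:Z) = (-1) ^ (- i%:Z).
  rewrite -mul2n PoszM -mulrN -exprz_exp.
  by rewrite -exprnP sqr_i.
rewrite /sign_unit opprD (expfzDr _ _ N0') (expfzDr _ _ i0) i2 mulrACA.
have -> : (-1 : R[i]) ^ i * (-1) ^ (- i%:Z) = 1.
  by rewrite -(expfzDr _ _ N0') addrN expr0z.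
by rewrite mulr1.
Qed.

Lemma real_hodge_form_sym p (e : nat) u v :
  let z := sign_unit p (k%:Z + e%:Z) in
  real_hodge_form z v u = (-1) ^+ e * real_hodge_form z u v.
Proof.
move=> z; have zJ : (z^*)%C = (-1) ^+ (k + e) * z by exact: sign_unit_conj.
have Qs x y : Q x y = (-1) ^+ k * Q y x := phl_parity Hmod x y.
rewrite !real_hodge_formE (Qs v.1) (Qs v.2) (Qs v.2) (Qs v.1 u.2).
move: (z) zJ => [x y]; rewrite -(signr_odd R[i] (k + e)) oddD.
rewrite -(signr_odd R k) -(signr_odd R e).
case: (odd k) (odd e) => [] [] /=; rewrite ?(expr0, expr1, mul1r, mulN1r, opprK);
  move=> /eqP; rewrite eq_complex /= => /andP[/eqP zx /eqP zy].
- have -> : y = 0 by lra.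
  by ring.
- have -> : x = 0 by lra.
  by ring.
- have -> : x = 0 by lra.
  by ring.
- have -> : y = 0 by lra.
  by ring.
Qed.

(** The chain through the type [(p, q)] is started at degree 0 or 1. *)
Lemma word_kernel (s : seq 'End(V)) (p q : int) (u : X) : word_in C s ->
  p + q = (size s)%:Z + k%:Z -> (u : VC) \in Vpq p q -> cword_act s u = 0 -> u = 0.
Proof.
move=> Cs; set m := size s => pq upq su.
have [Cconv Ca CN0 Clef] := Hcone.
pose e : nat := odd m; pose i0 := m./2.
have mE : m = (e + i0.*2)%N by rewrite odd_double_half.
pose P := p - i0%:Z; pose P' := q - i0%:Z.
have PP' : P + P' = e%:Z + k%:Z by rewrite /P /P'; lia.
have deg (i : nat) : (P + i%:Z) + (P' + i%:Z) = (e + i.*2)%N%:Z + k%:Z by lia.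
have /choice[E EP] (i : nat) := realify (Vpq (P + i%:Z) (P' + i%:Z)).
pose z := sign_unit P (k%:Z + e%:Z).
pose M := (`|k%:Z - P|.+1)%N.
have iso (i : nat) := fun y => @N0_power_onto (e + i.*2) (P + i%:Z) (P' + i%:Z) y (deg i).
have nseq_type A r i x : C A -> x \in E i ->
    (cword_act (nseq r A) x : VC) \in Vpq (P + i%:Z - r%:Z) (P' + i%:Z - r%:Z).
  move=> CA; rewrite EP => /(cword_act_type (word_in_nseq (r := r) CA)).
  by rewrite size_nseq.
apply: (@mixed_injective R X 'End(V) cact C N0 (real_hodge_form z) e E
  _ _ Cconv _ (real_hodge_form_bilin z) _ _ _ _ M _ CN0 _ _ _ _ s i0 u Cs mE _ su).
- by move=> c A B [x y]; rewrite /cact /= !add_lfunE !scale_lfunE.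
- by move=> A c [x y] [x' y']; rewrite /cact /= !linearP.
- move=> A B [x y] CA CB; have := phl_abelian Hmod (Ca _ CA) (Ca _ CB) => AB.
  have ABx w : A (B w) = B (A w) by rewrite -!comp_lfunE AB.
  by rewrite /cact /= !ABx.
- by move=> A x y CA; apply: real_hodge_form_skew; exact: Ca.
- by rewrite /e; case: odd.
- by move=> x y; exact: real_hodge_form_sym.
- move=> A i x CA; rewrite !EP => /(bigrading_action Hbig (Ca _ CA)).
  by rewrite -!addrA -[i.+1]addn1 PoszD !addrK.
- move=> i Mi; apply/eqP; rewrite -subv0; apply/subvP => x.
  rewrite EP (bigrading_support Hbig) ?memv0 //.
  by rewrite negb_and; apply/orP; left; apply/negP; rewrite /M in Mi; lia.
- move=> A i x CA xE; rewrite cword_act_nseq => -[Ax1 Ax2].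
  have [x1 x2] : x.1 \in Vg (e + i.*2)%N%:Z /\ x.2 \in Vg (e + i.*2)%N%:Z.
    by apply: (Vpq_degree (deg i)); rewrite -EP.
  have [_ /(_ (e + i.*2)%N)[inj _]] := Clef A CA.
  case: x {xE} x1 x2 Ax1 Ax2 => x y /= x1 x2 Ax1 Ax2.
  by congr pair; apply: inj; rewrite ?mem0v // linear0.
- move=> A i x CA xE; have [y yV yE] := iso i _ (nseq_type A _ i x CA xE).
  by exists y; rewrite ?EP.
- move=> i x xE.
  have [|y yV yE] := iso i.+1 (cword_act (nseq (e + i.*2).+1 N0) x).
    have := nseq_type N0 (e + i.*2).+1 i x CN0 xE.
    rewrite doubleS !addnS.
    by congr (_ \in Vpq _ _); lia.
  by exists y; rewrite ?EP // -yE doubleS !addnS.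
- move=> i x xE x0 prim.
  have [x1 x2] : x.1 \in Vg (e + i.*2)%N%:Z /\ x.2 \in Vg (e + i.*2)%N%:Z.
    by apply: (Vpq_degree (deg i)); rewrite -EP.
  have [_ _ _ pos] := bigrading_polarized Hbig (e + i.*2)%N.
  have := pos (P + i%:Z) x; rewrite memv_cap complexify_spaceP.
  have -> : k%:Z + (e + i.*2)%N%:Z - (P + i%:Z) = P' + i%:Z by have := deg i; lia.
  rewrite -EP xE andbT /primitive_space !memv_cap x1 x2 !memv_ker.
  move: prim; rewrite cword_act_nseq => -[-> ->]; rewrite eqxx => /(_ isT x0).
  rewrite ltcE => /andP[_].
  rewrite /word_form /real_hodge_form /hodge_hermitian_form mulrA.
  have -> : (-1) ^ (P + i%:Z) * 'i%C ^ (- (k%:Z + (e + i.*2)%N%:Z)) = z.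
    by rewrite -/(sign_unit _ _) PoszD addrA sign_unit_shift.
  have powN y : - lfun_pow N0 (e + i.*2) y = lfun_pow N0 (e + i.*2) (- y).
    by rewrite linearN.
  by rewrite cword_act_nseq /complexify_form /conjv /= !powN.
- by rewrite EP /P /P' !subrK.
Qed.

End HodgeLefschetzModule.

Theorem theorem4p2 (R : realType) (V : vectType R) (Vg : int -> {vspace V})
    (k : nat) (Q : {biscalar V}) (a : {vspace 'End(V)}) (N0 : 'End(V))
    (C : set 'End(V)) (m : nat) (T : 'I_m -> 'End(V)) :
  polarized_hodge_lefschetz_module Vg k Q a N0 ->
  polarizing_cone Vg a N0 C ->
  (m <= k)%N ->
  (forall i, C (T i)) ->
  restricts_to_iso (lfun_prod T) (Vg m%:Z) (Vg (- m%:Z)).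
Proof.
move=> Hmod [Hcone _] _ CT.
have [Vpq Hbig] := phl_bigrading Hmod.
have [_ Ca CN0 Clef] := Hcone.
pose s := [seq T i | i <- index_enum 'I_m].
have sz : size s = m by rewrite size_map [index_enum _]unlock -enumT size_enum_ord.
have Cs : word_in C s by move=> _ /mapP[i _ ->].
have wordE (w : V * V) :
    word_act (@cact R V) s w = (lfun_prod T w.1, lfun_prod T w.2).
  rewrite /lfun_prod /s; elim: (index_enum 'I_m) => [|i r IH].
    by rewrite !big_nil !lfunE /=; case: w.
  by rewrite !big_cons [LHS]/= -/(word_act _ _ _) IH /cact /= !comp_lfunE.
have image_sub : (lfun_prod T @: Vg m%:Z <= Vg (- m%:Z))%VS.
  apply/subvP => _ /memv_imgP[x xV ->].
  have -> : lfun_prod T x = (word_act (@cact R V) s (x, 0)).1 by rewrite wordE.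
  suff deg (r : seq 'End(V)) : word_in C r ->
      (word_act (@cact R V) r (x, 0)).1 \in Vg (m%:Z - (size r).*2%:Z).
    by have := deg s Cs; rewrite sz; have -> : - m%:Z = m%:Z - m.*2%:Z by lia.
  elim: r => [|A r IH] Cr /=; first by rewrite subr0.
  have [CA Cr'] := word_in_cons Cr.
  have [_ degA] := phl_algebra Hmod (Ca _ CA).
  have -> : m%:Z - (size r).+1.*2%:Z = m%:Z - (size r).*2%:Z - 2 by lia.
  exact: (subvP (degA _)) (memv_img A (IH Cr')).
have [_ /(_ m)[N0inj N0im]] := Clef N0 CN0.
have ker0 x : x \in Vg m%:Z -> lfun_prod T x = 0 -> x = 0.
  move=> xV Tx.
  have xC : (of_real x) \in complexify_space (Vg m%:Z).
    by rewrite complexify_spaceP /= xV mem0v.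
  have [r [f [ur fU xf]]] := direct_sum_mem (bigrading_graded Hbig m%:Z) xC.
  pose h w : complexification V := word_act (@cact R V) s w.
  have hD : {morph h : u v / u + v}.
    by move=> u v; rewrite /h !wordE; congr pair; rewrite linearD.
  have h0 : h 0 = 0 by rewrite /h wordE; congr pair; rewrite linear0.
  have sum0 : \sum_(i <- r) h (f i) = 0.
    rewrite -(big_morph h hD h0) -xf /h wordE /of_real /= Tx linear0.
    by [].
  have hU i : h (f i) \in Vpq (i - m%:Z) (- m%:Z + k%:Z - (i - m%:Z)).
    have := cword_act_type Hbig Hcone Cs (fU i); rewrite sz.
    by have -> : m%:Z + k%:Z - i - m%:Z = - m%:Z + k%:Z - (i - m%:Z) by lia.
  pose g (j : int) := h (f (j + m%:Z)).
  have gU j : g j \in Vpq j (- m%:Z + k%:Z - j).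
    by have := hU (j + m%:Z); rewrite addrK.
  have us' : uniq [seq i - m%:Z | i <- r] by rewrite map_inj_uniq //; exact: addIr.
  have gsum : \sum_(j <- [seq i - m%:Z | i <- r]) g j = 0.
    by rewrite big_map -[RHS]sum0; apply: eq_bigr => i _; rewrite /g subrK.
  have f0 i : i \in r -> f i = 0.
    move=> ir; apply: (word_kernel Hmod Hbig Hcone Cs _ (fU i)).
      by rewrite sz; lia.
    have := direct_sum_zero (bigrading_graded Hbig (- m%:Z)) us' gU gsum.
    by move=> /(_ (i - m%:Z) (map_f _ ir)); rewrite /g subrK.
  by have := xf; rewrite big_seq big1 // => -[].
have inj : {in Vg m%:Z &, injective (lfun_prod T)}.
  move=> x y xV yV xy; apply/eqP; rewrite -subr_eq0; apply/eqP/ker0.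
    exact: memvB.
  by rewrite linearB /= xy subrr.
have dim_image (f : 'End(V)) : {in Vg m%:Z &, injective f} ->
    \dim (f @: Vg m%:Z) = \dim (Vg m%:Z).
  move=> finj; apply: limg_dim_eq; apply/eqP; rewrite -subv0; apply/subvP => x.
  rewrite memv_cap memv_ker memv0 => /andP[xV /eqP fx]; apply/eqP.
  by apply: finj; rewrite ?mem0v // linear0.
split=> //; apply/eqP; rewrite -(dimv_leqif_eq image_sub).
by rewrite (dim_image _ inj) -N0im (dim_image _ N0inj).
Qed.
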